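(* The assignment $C\mapsto C_{\Omega K^{T^{\star\star}}C}$ from bipointed computads to computads extends to a functor $\Omega:\mathrm{Comp}^{\star\star}\to\mathrm{Comp}$ such that the following hold up to natural isomorphism: $K^T\circ\Omega\cong\Omega\circ K^{T^{\star\star}}:\mathrm{Comp}^{\star\star}\to\omega\mathrm{Cat}$ and $\mathrm{Cell}\circ\Omega\cong\Omega\circ\mathrm{Cell}^{\star\star}:\mathrm{Comp}^{\star\star}\to\mathrm{Glob}$.
   Context: **Globular sets.** The category $\mathbb G$ of globes has objects $[n]$, $n\in\mathbb N$, and morphisms freely generated by $s_n,t_n:[n]\to[n+1]$ subject to $s_{n+1}s_n=t_{n+1}s_n$ and $s_{n+1}t_n=t_{n+1}t_n$. A globular set $X$ is a presheaf on $\mathbb G$: sets $X_n$ of $n$-cells and functions $\mathrm{src},\mathrm{tgt}:X_{n+1}\to X_n$ with $\mathrm{src}\,\mathrm{src}=\mathrm{src}\,\mathrm{tgt}$, $\mathrm{tgt}\,\mathrm{src}=\mathrm{tgt}\,\mathrm{tgt}$. Globular sets form the category $\mathrm{Glob}$. For an $n$-cell $x$ and $k<n$, $\mathrm{src}_kx$, $\mathrm{tgt}_kx$ are the iterated source and target in dimension $k$. $\mathbb D^n$ is the globular set represented by $[n]$. A bipointed globular set $(X,x_-,x_+)$ is a globular set with two distinguished $0$-cells; with basepoint-preserving morphisms these form $\mathrm{Glob}^{\star\star}$. The wedge $X\vee Y$ of bipointed globular sets is the pushout of $X\xleftarrow{x_+}\mathbb D^0\xrightarrow{y_-}Y$ with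 basepoints the images of $x_-$ and $y_+$; $\bigvee_{i=1}^nX_i$ is the iterated wedge (the empty wedge is $\mathbb D^0$ with both basepoints its unique $0$-cell). The suspension $\Sigma X$ of a globular set has $(\Sigma X)_0=\{v_-,v_+\}$, $(\Sigma X)_{n+1}=X_n$, source and target of cells of dimension $\ge2$ as in $X$, and every $1$-cell has source $v_-$ and target $v_+$; basepoints are $v_-,v_+$. It is left adjoint to $\Omega:\mathrm{Glob}^{\star\star}\to\mathrm{Glob}$, $\Omega(X,x_-,x_+)_n=\{x\in X_{n+1}: \mathrm{src}_0x=x_-,\ \mathrm{tgt}_0x=x_+\}$, with identity unit ($\Omega\Sigma=\mathrm{id}$) and counit $\kappa:\Sigma\Omega\Rightarrow\mathrm{id}$ given by the inclusions. **Batanin trees.** A Batanin tree is (inductively) a finite list $\mathrm{br}[B_1,\dots,B_n]$ of Batanin trees, $n\ge0$. Its dimension is $\dim\mathrm{br}[\,]=0$, $\dim\mathrm{br}[B_1,\dots,B_n]=\max_i(\dim B_i+1)$. Its bipointed globular set of positions is $\mathrm{Pos}(\mathrm{br}[B_1,\dots,B_n])=\bigvee_{i=1}^n\Sigma\mathrm{Pos}(B_i)$. The $k$-boundary is $\partial_0B=\mathrm{br}[\,]$, $\partial_{k+1}\mathrm{br}[B_1,\dots,B_n]=\mathrm{br}[\partial_kB_1,\dots,\partial_kB_n]$. The source and target inclusions $s_k^B,t_k^B:\mathrm{Pos}(\partial_kB)\to\mathrm{Pos}(B)$ are: $s_0^B,t_0^B$ pick the first and second basepoint; $s_{k+1}^B=\bigvee_i\Sigma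 s_k^{B_i}$, $t_{k+1}^B=\bigvee_i\Sigma t_k^{B_i}$ for $B=\mathrm{br}[B_1,\dots,B_n]$. **Computads.** By mutual recursion on $n$ one defines categories $\mathrm{Comp}_n$ of $n$-computads, forgetful functors $u_n:\mathrm{Comp}_n\to\mathrm{Comp}_{n-1}$, functors $\mathrm{Free}_n:\mathrm{Glob}\to\mathrm{Comp}_n$, $\mathrm{Cell}_n,\mathrm{Sph}_n:\mathrm{Comp}_n\to\mathrm{Set}$ and natural transformations $\mathrm{bdry}_n:\mathrm{Cell}_n\Rightarrow\mathrm{Sph}_{n-1}u_n$ and $\mathrm{pr}_1,\mathrm{pr}_2:\mathrm{Sph}_n\Rightarrow\mathrm{Cell}_n$. Base: $\mathrm{Comp}_{-1}$ is terminal and $\mathrm{Sph}_{-1}$ picks a one-element set. An $n$-computad is $C=(C_{n-1},V_n^C,\phi_n^C)$ with $C_{n-1}$ an $(n-1)$-computad, $V_n^C$ a set (generators), $\phi_n^C:V_n^C\to\mathrm{Sph}_{n-1}(C_{n-1})$. A morphism $\sigma:C\to D$ is a pair $(\sigma_{n-1}:C_{n-1}\to D_{n-1},\ \sigma_V=\sigma_{n,V}:V_n^C\to\mathrm{Cell}_nD)$ with $\mathrm{bdry}_{n,D}\circ\sigma_V=\mathrm{Sph}_{n-1}(\sigma_{n-1})\circ\phi_n^C$; composition is $\sigma\circ\tau=(\sigma_{n-1}\tau_{n-1},\mathrm{Cell}_n(\sigma)\circ\tau_V)$, identities are $(\mathrm{id},\mathrm{var})$, and $u_n$ is projection. The set $\mathrm{Cell}_nC$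 is inductively generated by: $\mathrm{var}\,v$ for $v\in V_n^C$; and, if $n>0$, coherence cells $\mathrm{coh}(B,A,\tau)$, where $B$ is a Batanin tree with $\dim B\le n$, $A\in\mathrm{Sph}_{n-1}(\mathrm{Free}_{n-1}\mathrm{Pos}(B))$ is full (see below) and $\tau:\mathrm{Free}_n\mathrm{Pos}(B)\to C$ is a morphism. Boundaries: $\mathrm{bdry}(\mathrm{var}\,v)=\phi_n^C(v)$, $\mathrm{bdry}(\mathrm{coh}(B,A,\tau))=\mathrm{Sph}_{n-1}(\tau_{n-1})(A)$. Action of $\sigma:C\to D$: $\mathrm{var}\,v\mapsto\sigma_V(v)$, $\mathrm{coh}(B,A,\tau)\mapsto\mathrm{coh}(B,A,\sigma\circ\tau)$. $\mathrm{Sph}_nC=\{(a,b)\in(\mathrm{Cell}_nC)^2:\mathrm{bdry}_na=\mathrm{bdry}_nb\}$ with projections $\mathrm{pr}_1,\mathrm{pr}_2$. $\mathrm{Free}_nX=(\mathrm{Free}_{n-1}X,X_n,x\mapsto(\mathrm{var}(\mathrm{src}\,x),\mathrm{var}(\mathrm{tgt}\,x)))$, acting on $f$ by $(\mathrm{Free}_{n-1}f,\mathrm{var}\circ f_n)$. Support of a cell: $\mathrm{supp}(\mathrm{var}\,v)=\{v\}$ if $n=0$ and $\{v\}\cup\mathrm{supp}(\mathrm{pr}_1\phi_n^C(v))\cup\mathrm{supp}(\mathrm{pr}_2\phi_n^C(v))$ if $n>0$; $\mathrm{supp}(\mathrm{coh}(B,A,\tau))=\bigcup_{k\le n}\bigcup_{p\in\mathrm{Pos}(B)_k}\mathrm{supp}(\tau_{k,V}(p))$.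 A sphere $(a,b)\in\mathrm{Sph}_n(\mathrm{Free}_n\mathrm{Pos}(B))$ is full if $a=\mathrm{Cell}_n\mathrm{Free}_n(s_n^B)(a')$ and $b=\mathrm{Cell}_n\mathrm{Free}_n(t_n^B)(b')$ for $n$-cells $a',b'$ of $\mathrm{Free}_n\mathrm{Pos}(\partial_nB)$ whose supports contain all positions of $\partial_nB$. $\mathrm{Comp}$ is the limit of the $\mathrm{Comp}_n$: a computad is a sequence $C=(C_n)_n$ with $u_{n+1}C_{n+1}=C_n$. $\mathrm{Free}:\mathrm{Glob}\to\mathrm{Comp}$ has components $\mathrm{Free}_n$; $\mathrm{Cell}:\mathrm{Comp}\to\mathrm{Glob}$ sends $C$ to the globular set with $n$-cells $\mathrm{Cell}_nC_n$, and source and target the projections of $\mathrm{bdry}$. $\mathrm{Free}\dashv\mathrm{Cell}$ with unit $\eta(x)=\mathrm{var}\,x$ and counit $\varepsilon_C:\mathrm{Free}\,\mathrm{Cell}\,C\to C$ given on generators by the identities $V_n^{\mathrm{Free}\,\mathrm{Cell}\,C}=\mathrm{Cell}_nC$. Let $T=\mathrm{Cell}\,\mathrm{Free}$ with its induced monad structure $(T,\mu,\eta)$. An (weak) $\omega$-category is a $T$-algebra; they form $\omega\mathrm{Cat}$. The comparison functor $K^T:\mathrm{Comp}\to\omega\mathrm{Cat}$ is $C\mapsto(\mathrm{Cell}\,C,\mathrm{Cell}\,\varepsilon_C)$. For an $n$-computad $C$, $K^T_nC$ denotes the $\omega$-category $K^T$ of $C$ regarded as a computad with no generators in dimensions $>n$.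 **Bipointed versions.** $\mathrm{Comp}^{\star\star}$ is the category of computads with two chosen $0$-cells and morphisms preserving them; $\omega\mathrm{Cat}^{\star\star}$ is the category of $\omega$-categories with two chosen $0$-cells and morphisms preserving them. The adjunction lifts to $\mathrm{Free}^{\star\star}:\mathrm{Glob}^{\star\star}\rightleftarrows\mathrm{Comp}^{\star\star}:\mathrm{Cell}^{\star\star}$, with $\mathrm{Free}^{\star\star}(X,x_\pm)=(\mathrm{Free}X,\mathrm{var}\,x_\pm)$, $\mathrm{Cell}^{\star\star}(C,c_\pm)=(\mathrm{Cell}\,C,c_\pm)$; the induced monad is $T^{\star\star}(X,x_\pm)=(TX,\mathrm{var}\,x_\pm)$, whose algebras are the bipointed $\omega$-categories; $K^{T^{\star\star}}:\mathrm{Comp}^{\star\star}\to\omega\mathrm{Cat}^{\star\star}$ is the comparison functor. **Suspension of computads.** Put $\Sigma B=\mathrm{br}[B]$, so $\mathrm{Pos}(\Sigma B)=\Sigma\mathrm{Pos}(B)$. Functors $\Sigma:\mathrm{Comp}_n\to\mathrm{Comp}_{n+1}$ and natural transformations $\Sigma^{\mathrm{Cell}}:\mathrm{Cell}_n\Rightarrow\mathrm{Cell}_{n+1}\Sigma$, $\Sigma^{\mathrm{Sph}}:\mathrm{Sph}_n\Rightarrow\mathrm{Sph}_{n+1}\Sigma$ are defined recursively: for $n=-1$, $\Sigma$ picks the set $\{v_-,v_+\}\in\mathrm{Comp}_0=\mathrm{Set}$ and $\Sigma^{\mathrm{Sph}}$ picks $(\mathrm{var}\,v_-,\mathrm{var}\,v_+)$;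 for $n\ge0$, $\Sigma C=(\Sigma C_{n-1},V_n^C,\Sigma^{\mathrm{Sph}}\circ\phi_n^C)$, $\Sigma\sigma=(\Sigma\sigma_{n-1},\Sigma^{\mathrm{Cell}}\circ\sigma_V)$, $\Sigma^{\mathrm{Cell}}(\mathrm{var}\,v)=\mathrm{var}\,v$, $\Sigma^{\mathrm{Cell}}(\mathrm{coh}(B,A,\tau))=\mathrm{coh}(\Sigma B,\Sigma^{\mathrm{Sph}}A,\Sigma\tau)$, $\Sigma^{\mathrm{Sph}}(a,b)=(\Sigma^{\mathrm{Cell}}a,\Sigma^{\mathrm{Cell}}b)$. (These are well defined and $\Sigma\,\mathrm{Free}_n=\mathrm{Free}_{n+1}\Sigma$.) They assemble to $\Sigma:\mathrm{Comp}\to\mathrm{Comp}^{\star\star}$ with $(\Sigma C)_0=\{v_-,v_+\}$, $(\Sigma C)_{n+1}=\Sigma C_n$, basepoints $\mathrm{var}\,v_\pm$, satisfying $\Sigma\,\mathrm{Free}=\mathrm{Free}^{\star\star}\Sigma$, and to $\Sigma^{\mathrm{Cell}}:\Sigma\,\mathrm{Cell}\Rightarrow\mathrm{Cell}^{\star\star}\Sigma$ (sending $v_\pm$ to $\mathrm{var}\,v_\pm$). **Hom $\omega$-categories.** Let $\Sigma^T=\Sigma^{\mathrm{Cell}}\mathrm{Free}:\Sigma T\Rightarrow T^{\star\star}\Sigma$ and let $\Omega^T=(\Omega T^{\star\star}\kappa)\circ(\Omega\Sigma^T\Omega):T\Omega\Rightarrow\Omega T^{\star\star}$. The hom $\omega$-category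 of a bipointed $\omega$-category $(X,\alpha:TX\to X,x_-,x_+)$ is $\Omega(X,x_-,x_+)$ with structure map $T\Omega X\xrightarrow{\Omega^T}\Omega T^{\star\star}X\xrightarrow{\Omega\alpha}\Omega X$. This defines a functor $\Omega:\omega\mathrm{Cat}^{\star\star}\to\omega\mathrm{Cat}$. **The computad $C_{\mathbb X}$ of an $\omega$-category.** Let $\mathbb X=(X,\alpha:TX\to X)$ be an $\omega$-category. An $n$-cell of $\mathbb X$ is indecomposable if it is not of the form $\alpha(\mathrm{coh}(B,A,\mathrm{Free}\,\sigma))$ for any Batanin tree $B$, full $(n-1)$-sphere $A$ of $\mathrm{Free}_{n-1}\mathrm{Pos}(B)$ and morphism $\sigma:\mathrm{Pos}(B)\to X$; $X_n^{\mathrm{ind}}\subseteq X_n$ is the set of indecomposable $n$-cells. $\mathrm{Par}_{n-1}(X)$ is the set of pairs of parallel $(n-1)$-cells of $X$ (a one-element set for $n=0$). Define recursively $n$-computads $C_{\mathbb X,n}$ and morphisms $\sigma_{\mathbb X,n}:K_n^TC_{\mathbb X,n}\to\mathbb X$: $C_{\mathbb X,-1}$ is the unique $(-1)$-computad and $\sigma_{\mathbb X,-1}$ is the unique morphism from the initial $\omega$-category; $C_{\mathbb X,n}=(C_{\mathbb X,n-1},V_n^{\mathbb X},\phi_n^{\mathbb X})$, where $V_n^{\mathbb X}$, with projections $\phi_n^{\mathbb X}$ to $\mathrm{Sph}_{n-1}(C_{\mathbb X,n-1})$ and $\sigma^{\mathrm{ind}}_{\mathbb X,n,V}$ to $X_n^{\mathrm{ind}}$,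 is the pullback of $(\sigma_{\mathbb X,n-1},\sigma_{\mathbb X,n-1}):\mathrm{Sph}_{n-1}(C_{\mathbb X,n-1})\to\mathrm{Par}_{n-1}(X)$ and $X_n^{\mathrm{ind}}\hookrightarrow X_n\xrightarrow{(\mathrm{src},\mathrm{tgt})}\mathrm{Par}_{n-1}(X)$; and $\sigma_{\mathbb X,n}$ is the morphism determined by $\sigma_{\mathbb X,n-1}$ and, on $n$-dimensional generators, $V_n^{\mathbb X}\to X_n^{\mathrm{ind}}\hookrightarrow X_n$. Finally $C_{\mathbb X}=(C_{\mathbb X,n})_n$. *)

(* Defs.v *)
Set Warnings "-notation-overridden".
From Stdlib Require Import FunctionalExtensionality ProofIrrelevance.
From mathcomp Require Import all_boot.

Set Implicit Arguments.
Unset Strict Implicit.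
Unset Printing Implicit Defensive.

Record category := Category {
  ob :> Type;
  hom : ob -> ob -> Type;
  idm : forall a, hom a a;
  comp : forall a b c, hom b c -> hom a b -> hom a c;
  comp1f : forall a b (f : hom a b), comp (idm b) f = f;
  compf1 : forall a b (f : hom a b), comp f (idm a) = f;
  compA : forall a b c d (h : hom c d) (g : hom b c) (f : hom a b),
    comp h (comp g f) = comp (comp h g) f }.

Arguments hom {c0} a b : rename.
Arguments idm {c0} a : rename.
Arguments comp {c0 a b c} g f : rename.
Arguments comp1f {c0 a b} f : rename.
Arguments compf1 {c0 a b} f : rename.
Arguments compA {c0 a b c d} h g f : rename.
Notation "g \oc f" := (comp g f) (at level 50, left associativity).

Record functoriality (C D : category) (F : C -> D) := Functoriality {
  fact : forall a b, hom a b -> hom (F a) (F b);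
  fact_id : forall a, fact (idm a) = idm (F a);
  fact_comp : forall a b c (g : hom b c) (f : hom a b),
    fact (g \oc f) = fact g \oc fact f }.

Record functor (C D : category) := Functor {
  fob :> C -> D;
  fstr : functoriality fob }.

Definition fmap (C D : category) (F : functor C D) (a b : C) (f : hom a b) :
  hom (F a) (F b) := fact (fstr F) f.

Lemma fmap_id C D (F : functor C D) a : fmap F (idm a) = idm (F a).
Proof. exact: fact_id. Qed.

Lemma fmap_comp C D (F : functor C D) a b c (g : hom b c) (f : hom a b) :
  fmap F (g \oc f) = fmap F g \oc fmap F f.
Proof. exact: fact_comp. Qed.

Definition fcomp (C D E : category) (G : functor D E) (F : functor C D) : functor C E.
Proof.
apply: (@Functor _ _ (fun a => G (F a))).
apply: (@Functoriality _ _ _ (fun a b f => fmap G (fmap F f))) => [a|a b c g f].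
- by rewrite !fmap_id.
- by rewrite !fmap_comp.
Defined.

Record natiso (C D : category) (F G : functor C D) := NatIso {
  nat_fun : forall a, hom (F a) (G a);
  nat_inv : forall a, hom (G a) (F a);
  nat_funK : forall a, nat_inv a \oc nat_fun a = idm (F a);
  nat_invK : forall a, nat_fun a \oc nat_inv a = idm (G a);
  nat_natural : forall a b (f : hom a b),
    nat_fun b \oc fmap F f = fmap G f \oc nat_fun a }.

Definition TYPE : category :=
  @Category Type (fun A B => A -> B) (fun A => id) (fun A B C g f x => g (f x))
    (fun _ _ _ => erefl) (fun _ _ _ => erefl) (fun _ _ _ _ _ _ _ => erefl).

Definition ONE : category :=
  @Category unit (fun _ _ => unit) (fun _ => tt) (fun _ _ _ _ _ => tt)
    (fun _ _ f => match f with tt => erefl end)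
    (fun _ _ f => match f with tt => erefl end)
    (fun _ _ _ _ _ _ _ => erefl).

(* The isomorphism underlying an equality of objects. *)
Definition idto (C : category) (a b : C) (e : a = b) : hom a b :=
  match e in _ = b return hom a b with erefl => idm a end.

Lemma idto_id (C : category) (a : C) (e : a = a) : idto e = idm a.
Proof. by rewrite (proof_irrelevance _ e erefl). Qed.

Lemma idto_irr (C : category) (a b : C) (e e' : a = b) : idto e = idto e'.
Proof. by rewrite (proof_irrelevance _ e e'). Qed.

Lemma idto_comp (C : category) (a b c : C) (e : a = b) (e' : b = c) :
  idto e' \oc idto e = idto (etrans e e').
Proof. by case: c / e'; rewrite comp1f; apply: idto_irr. Qed.

Lemma idtoK (C : category) (a b : C) (e : a = b) (e' : b = a) :
  idto e' \oc idto e = idm a.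
Proof. by rewrite idto_comp idto_id. Qed.

Lemma fmap_idto (C D : category) (F : functor C D) (a b : C) (e : a = b) :
  fmap F (idto e) = idto (congr1 F e).
Proof. by case: b / e; rewrite /= fmap_id. Qed.

Record glob := Glob {
  gcell :> nat -> Type;
  src : forall n, gcell n.+1 -> gcell n;
  tgt : forall n, gcell n.+1 -> gcell n;
  src_glob : forall n (x : gcell n.+2), src (src x) = src (tgt x);
  tgt_glob : forall n (x : gcell n.+2), tgt (src x) = tgt (tgt x) }.

Arguments src {g n} x : rename.
Arguments tgt {g n} x : rename.

Record globhom (X Y : glob) := GlobHom {
  gmap :> forall n, X n -> Y n;
  gmap_src : forall n (x : X n.+1), src (gmap x) = gmap (src x);
  gmap_tgt : forall n (x : X n.+1), tgt (gmap x) = gmap (tgt x) }.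

Arguments gmap {X Y} f {n} x : rename.

Lemma globhom_ext (X Y : glob) (f g : globhom X Y) :
  (forall n (x : X n), f n x = g n x) -> f = g.
Proof.
case: f g => [f fs ft] [g gs gt] /= fg.
have e : f = g by apply: functional_extensionality_dep => n;
  apply: functional_extensionality => x; apply: fg.
by case: g / e gs gt {fg} => gs gt; congr GlobHom; apply: proof_irrelevance.
Qed.

Definition globhom_id (X : glob) : globhom X X :=
  @GlobHom X X (fun _ x => x) (fun _ _ => erefl) (fun _ _ => erefl).

Definition globhom_comp (X Y Z : glob) (g : globhom Y Z) (f : globhom X Y) :
  globhom X Z.
Proof.
by apply: (@GlobHom X Z (fun n x => g n (f n x))) => n x;
  rewrite ?gmap_src ?gmap_tgt.
Defined.

Definition GLOB : category.
Proof.
by apply: (@Category glob globhom globhom_id globhom_comp) => *; apply: globhom_ext.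
Defined.

Record bglob := BGlob { bglob_glob :> glob; bminus : bglob_glob 0; bplus : bglob_glob 0 }.

Arguments bminus : clear implicits.
Arguments bplus : clear implicits.

Record bglobhom (X Y : bglob) := BGlobHom {
  bglobhom_hom :> globhom X Y;
  bglobhom_minus : bglobhom_hom 0 (bminus X) = bminus Y;
  bglobhom_plus : bglobhom_hom 0 (bplus X) = bplus Y }.

Lemma bglobhom_ext (X Y : bglob) (f g : bglobhom X Y) :
  (forall n (x : X n), f n x = g n x) -> f = g.
Proof.
case: f g => [f fm fp] [g gm gp] /= /(@globhom_ext _ _ f g) e.
by case: g / e gm gp => gm gp; congr BGlobHom; apply: proof_irrelevance.
Qed.

Definition bglobhom_id (X : bglob) : bglobhom X X :=
  @BGlobHom X X (globhom_id X) erefl erefl.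

Definition bglobhom_comp (X Y Z : bglob) (g : bglobhom Y Z) (f : bglobhom X Y) :
  bglobhom X Z.
Proof.
by apply: (@BGlobHom X Z (globhom_comp g f));
  rewrite /= ?bglobhom_minus ?bglobhom_plus.
Defined.

Definition BGLOB : category.
Proof.
by apply: (@Category bglob bglobhom bglobhom_id bglobhom_comp) => *;
  apply: bglobhom_ext.
Defined.

(* [false] and [true] are the basepoints v_- and v_+. *)
Definition susp_cell (X : nat -> Type) (n : nat) : Type :=
  match n with 0 => bool | n'.+1 => X n' end.

Definition gsusp_src (X : glob) (n : nat) : susp_cell X n.+1 -> susp_cell X n :=
  match n with 0 => fun=> false | n'.+1 => fun x => src x end.

Definition gsusp_tgt (X : glob) (n : nat) : susp_cell X n.+1 -> susp_cell X n :=
  match n with 0 => fun=> true | n'.+1 => fun x => tgt x end.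

Lemma gsusp_src_glob (X : glob) n (x : susp_cell X n.+2) :
  gsusp_src (gsusp_src x) = gsusp_src (gsusp_tgt x).
Proof. by case: n x => //= n x; apply: src_glob. Qed.

Lemma gsusp_tgt_glob (X : glob) n (x : susp_cell X n.+2) :
  gsusp_tgt (gsusp_src x) = gsusp_tgt (gsusp_tgt x).
Proof. by case: n x => //= n x; apply: tgt_glob. Qed.

Definition gsusp (X : glob) : bglob :=
  @BGlob (Glob (@gsusp_src_glob X) (@gsusp_tgt_glob X)) false true.

Definition gsusp_map_cell (X Y : glob) (f : globhom X Y) (n : nat) :
    gsusp X n -> gsusp Y n :=
  match n with 0 => fun x => x | n'.+1 => fun x => f n' x end.

Lemma gsusp_map_src (X Y : glob) (f : globhom X Y) n (x : gsusp X n.+1) :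
  src (gsusp_map_cell f x) = gsusp_map_cell f (src x).
Proof. by case: n x => //= n x; apply: gmap_src. Qed.

Lemma gsusp_map_tgt (X Y : glob) (f : globhom X Y) n (x : gsusp X n.+1) :
  tgt (gsusp_map_cell f x) = gsusp_map_cell f (tgt x).
Proof. by case: n x => //= n x; apply: gmap_tgt. Qed.

Definition gsusp_hom (X Y : glob) (f : globhom X Y) : globhom (gsusp X) (gsusp Y) :=
  GlobHom (gsusp_map_src f) (gsusp_map_tgt f).

Definition gsusp_map (X Y : glob) (f : globhom X Y) : bglobhom (gsusp X) (gsusp Y) :=
  @BGlobHom (gsusp X) (gsusp Y) (gsusp_hom f) erefl erefl.

Definition GSUSP : functor GLOB BGLOB.
Proof.
apply: (@Functor GLOB BGLOB gsusp); apply: (@Functoriality GLOB BGLOB _ gsusp_map).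
- by move=> X; apply: bglobhom_ext; case.
- by move=> X Y Z g f; apply: bglobhom_ext; case.
Defined.

Definition disk0_cell (n : nat) : Type :=
  match n with 0 => unit | _.+1 => Empty_set end.

Definition disk0 : bglob :=
  @BGlob (@Glob disk0_cell (fun _ (x : Empty_set) => match x with end)
    (fun _ (x : Empty_set) => match x with end)
    (fun _ (x : Empty_set) => match x with end)
    (fun _ (x : Empty_set) => match x with end)) tt tt.

(* The wedge of [gsusp X] and [Y].  The pushout identifies v_+ with the first
   basepoint of [Y], so its 0-cells are v_-, here [None], and those of [Y]. *)
Definition wedge_cell (X Y : nat -> Type) (n : nat) : Type :=
  match n with 0 => option (Y 0) | n'.+1 => (X n' + Y n'.+1)%type end.

Definition wedge_src (X : glob) (Y : bglob) (n : nat) :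
    wedge_cell X Y n.+1 -> wedge_cell X Y n :=
  match n return wedge_cell X Y n.+1 -> wedge_cell X Y n with
  | 0 => fun x => match x with inl _ => None | inr y => Some (src y) end
  | n'.+1 => fun x => match x with inl x => inl (src x) | inr y => inr (src y) end
  end.

Definition wedge_tgt (X : glob) (Y : bglob) (n : nat) :
    wedge_cell X Y n.+1 -> wedge_cell X Y n :=
  match n return wedge_cell X Y n.+1 -> wedge_cell X Y n with
  | 0 => fun x => match x with inl _ => Some (bminus Y) | inr y => Some (tgt y) end
  | n'.+1 => fun x => match x with inl x => inl (tgt x) | inr y => inr (tgt y) end
  end.

Lemma wedge_src_glob (X : glob) (Y : bglob) n (x : wedge_cell X Y n.+2) :
  wedge_src (wedge_src x) = wedge_src (wedge_tgt x).
Proof. by case: n x => [|n] [x|y] //=; rewrite src_glob. Qed.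

Lemma wedge_tgt_glob (X : glob) (Y : bglob) n (x : wedge_cell X Y n.+2) :
  wedge_tgt (wedge_src x) = wedge_tgt (wedge_tgt x).
Proof. by case: n x => [|n] [x|y] //=; rewrite tgt_glob. Qed.

Definition wedge (X : glob) (Y : bglob) : bglob :=
  @BGlob (Glob (@wedge_src_glob X Y) (@wedge_tgt_glob X Y)) None (Some (bplus Y)).

Definition wedge_inl_cell (X : glob) (Y : bglob) (n : nat) : gsusp X n -> wedge X Y n :=
  match n return gsusp X n -> wedge X Y n with
  | 0 => fun b => if b then Some (bminus Y) else None
  | n'.+1 => inl
  end.

Definition wedge_inl (X : glob) (Y : bglob) : globhom (gsusp X) (wedge X Y).
Proof. by apply: (@GlobHom _ _ (@wedge_inl_cell X Y)) => -[]. Defined.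

Definition wedge_inr_cell (X : glob) (Y : bglob) (n : nat) : Y n -> wedge X Y n :=
  match n return Y n -> wedge X Y n with 0 => Some | n'.+1 => inr end.

Definition wedge_inr (X : glob) (Y : bglob) : globhom Y (wedge X Y).
Proof. by apply: (@GlobHom _ _ (@wedge_inr_cell X Y)) => -[]. Defined.

Lemma wedge_glue X Y : wedge_inl X Y 0 (bplus (gsusp X)) = wedge_inr X Y 0 (bminus Y).
Proof. by []. Qed.

Lemma wedge_pushout (X : glob) (Y : bglob) (Z : glob)
    (f : globhom (gsusp X) Z) (g : globhom Y Z) :
  f 0 (bplus (gsusp X)) = g 0 (bminus Y) ->
  exists! h : globhom (wedge X Y) Z,
    globhom_comp h (wedge_inl X Y) = f /\ globhom_comp h (wedge_inr X Y) = g.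
Proof.
move=> fg.
pose h n : wedge X Y n -> Z n :=
  match n return wedge X Y n -> Z n with
  | 0 => fun x => match x with None => f 0 false | Some y => g 0 y end
  | n'.+1 => fun x => match x with inl x => f n'.+1 x | inr y => g n'.+1 y end end.
have hs n (x : wedge X Y n.+1) : src (h _ x) = h _ (src x).
  by case: n x => [|n] [x|x] /=; rewrite gmap_src.
have ht n (x : wedge X Y n.+1) : tgt (h _ x) = h _ (tgt x).
  by case: n x => [|n] [x|x] /=; rewrite gmap_tgt.
exists (GlobHom hs ht); split.
  by split; apply: globhom_ext; case=> [|n] //= [].
move=> k [kf kg]; apply: globhom_ext; case=> [|n] [x|] /=.
- by rewrite -kg.
- by rewrite -kf.
- by rewrite -kf.
- by move=> y; rewrite -kg.
Qed.

Definition wedge_map_cell (X X' : glob) (Y Y' : bglob) (f : globhom X X')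
    (g : globhom Y Y') (n : nat) : wedge X Y n -> wedge X' Y' n :=
  match n return wedge X Y n -> wedge X' Y' n with
  | 0 => fun x => match x with None => None | Some y => Some (g 0 y) end
  | n'.+1 => fun x => match x with inl x => inl (f n' x) | inr y => inr (g n'.+1 y) end
  end.

Lemma wedge_map_src (X X' : glob) (Y Y' : bglob) (f : globhom X X')
  (g : bglobhom Y Y') n (x : wedge X Y n.+1) :
  src (wedge_map_cell f g x) = wedge_map_cell f g (src x).
Proof. by case: n x => [|n] [x|y] //=; rewrite gmap_src. Qed.

Lemma wedge_map_tgt (X X' : glob) (Y Y' : bglob) (f : globhom X X')
  (g : bglobhom Y Y') n (x : wedge X Y n.+1) :
  tgt (wedge_map_cell f g x) = wedge_map_cell f g (tgt x).
Proof. by case: n x => [|n] [x|y] //=; rewrite ?bglobhom_minus ?gmap_tgt. Qed.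

Definition wedge_map (X X' : glob) (Y Y' : bglob) (f : globhom X X')
    (g : bglobhom Y Y') : bglobhom (wedge X Y) (wedge X' Y') :=
  @BGlobHom (wedge X Y) (wedge X' Y')
    (GlobHom (@wedge_map_src _ _ _ _ f g) (@wedge_map_tgt _ _ _ _ f g))
    erefl (congr1 Some (bglobhom_plus g)).

(* The iterated wedge of the suspensions of the members of a list.  The wedge of
   a single bipointed globular set is that set on the nose. *)
Fixpoint wedges (l : seq glob) : bglob :=
  match l with
  | [::] => disk0
  | X :: l' => match l' with [::] => gsusp X | _ :: _ => wedge X (wedges l') end
  end.

Fixpoint src0 (X : glob) (n : nat) : X n -> X 0 :=
  match n with 0 => fun x => x | n'.+1 => fun x => src0 (src x) end.

Fixpoint tgt0 (X : glob) (n : nat) : X n -> X 0 :=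
  match n with 0 => fun x => x | n'.+1 => fun x => tgt0 (tgt x) end.

Lemma src0_map (X Y : glob) (f : globhom X Y) n (x : X n) : src0 (f n x) = f 0 (src0 x).
Proof. by elim: n x => //= n IH x; rewrite gmap_src IH. Qed.

Lemma tgt0_map (X Y : glob) (f : globhom X Y) n (x : X n) : tgt0 (f n x) = f 0 (tgt0 x).
Proof. by elim: n x => //= n IH x; rewrite gmap_tgt IH. Qed.

Lemma src0_tgt (X : glob) n (x : X n.+2) : src0 (tgt x) = src0 (src x).
Proof. by rewrite /= src_glob. Qed.

Lemma tgt0_src (X : glob) n (x : X n.+2) : tgt0 (src x) = tgt0 (tgt x).
Proof. by rewrite /= tgt_glob. Qed.

Definition gloop_cell (X : bglob) (n : nat) : Type :=
  {x : X n.+1 | src0 x = bminus X /\ tgt0 x = bplus X}.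

Lemma gloop_cell_eq (X : bglob) n (x y : gloop_cell X n) : sval x = sval y -> x = y.
Proof.
case: x y => [x px] [y py] /= e; case: y / e py => py.
by rewrite (proof_irrelevance _ px py).
Qed.

Lemma gloop_src_proof (X : bglob) n (x : gloop_cell X n.+1) :
  src0 (src (sval x)) = bminus X /\ tgt0 (src (sval x)) = bplus X.
Proof. by case: x => x /= [<- <-]; rewrite !tgt_glob. Qed.

Lemma gloop_tgt_proof (X : bglob) n (x : gloop_cell X n.+1) :
  src0 (tgt (sval x)) = bminus X /\ tgt0 (tgt (sval x)) = bplus X.
Proof. by case: x => x /= [<- <-]; rewrite !src_glob. Qed.

Definition gloop (X : bglob) : glob.
Proof.
apply: (@Glob (gloop_cell X) (fun n x => exist _ _ (gloop_src_proof x))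
  (fun n x => exist _ _ (gloop_tgt_proof x))) => n x; apply: gloop_cell_eq.
- exact: src_glob.
- exact: tgt_glob.
Defined.

Lemma gloop_map_proof (X Y : bglob) (f : bglobhom X Y) n (x : gloop X n) :
  src0 (f n.+1 (sval x)) = bminus Y /\ tgt0 (f n.+1 (sval x)) = bplus Y.
Proof.
by rewrite src0_map tgt0_map; case: (svalP x) => -> ->;
  rewrite bglobhom_minus bglobhom_plus.
Qed.

Definition gloop_map_cell (X Y : bglob) (f : bglobhom X Y) n (x : gloop X n) :
  gloop Y n := exist _ (f n.+1 (sval x)) (gloop_map_proof f x).

Definition gloop_map (X Y : bglob) (f : bglobhom X Y) : globhom (gloop X) (gloop Y).
Proof.
apply: (@GlobHom _ _ (@gloop_map_cell X Y f))
  => n x; apply: gloop_cell_eq.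
- exact: gmap_src.
- exact: gmap_tgt.
Defined.

Definition GLOOP : functor BGLOB GLOB.
Proof.
apply: (@Functor BGLOB GLOB gloop); apply: (@Functoriality BGLOB GLOB _ gloop_map).
- by move=> X; apply: globhom_ext => n x; apply: gloop_cell_eq.
- by move=> X Y Z g f; apply: globhom_ext => n x; apply: gloop_cell_eq.
Defined.

Lemma gloop_unit_proof (X : glob) n (x : gsusp X n.+1) :
  src0 x = bminus (gsusp X) /\ tgt0 x = bplus (gsusp X).
Proof.
by elim: n x => [|n IH] x //; split; [case: (IH (src x))|case: (IH (tgt x))].
Qed.

(* The unit X -> gloop (gsusp X), which is an identity up to the encoding of
   subsets as sigma types. *)
Definition gloop_unit (X : glob) : globhom X (gloop (gsusp X)).
Proof.
by apply: (@GlobHom X (gloop (gsusp X))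
  (fun n x => exist _ (x : gsusp X n.+1) (@gloop_unit_proof X n x))) => n x;
  apply: gloop_cell_eq.
Defined.

Definition gkappa_cell (X : bglob) (n : nat) : gsusp (gloop X) n -> X n :=
  match n return gsusp (gloop X) n -> X n with
  | 0 => fun b => if b then bplus X else bminus X
  | n'.+1 => fun x => sval x
  end.

Definition gkappa_hom (X : bglob) : globhom (gsusp (gloop X)) X.
Proof.
by apply: (@GlobHom (gsusp (gloop X)) X (@gkappa_cell X)) => -[|n] x //=;
  case: (svalP x).
Defined.

Definition gkappa (X : bglob) : bglobhom (gsusp (gloop X)) X :=
  @BGlobHom (gsusp (gloop X)) X (gkappa_hom X) erefl erefl.

Inductive tree := br of seq tree.

Fixpoint dim (B : tree) : nat :=
  match B with br l => foldr maxn 0 (map (fun B' => (dim B').+1) l) end.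

Fixpoint Pos (B : tree) : bglob :=
  match B with br l => wedges (map (fun B' => Pos B' : glob) l) end.

Fixpoint bd (k : nat) (B : tree) : tree :=
  match k, B with
  | 0, _ => br [::]
  | k'.+1, br l => br (map (bd k') l)
  end.

Lemma dim_bd (k : nat) (B : tree) : dim (bd k B) <= k.
Proof.
elim: k B => [|k IH] [l] //=.
by elim: l => //= B l IHl; rewrite geq_max ltnS IH.
Qed.

Fixpoint tree_list_ind (P : tree -> Prop)
    (HP : forall l, foldr (fun B Q => P B /\ Q) True l -> P (br l)) (B : tree) : P B :=
  match B with
  | br l => HP l ((fix all_P l : foldr (fun B Q => P B /\ Q) True l :=
      match l with
      | [::] => I
      | B' :: l' => conj (tree_list_ind HP B') (all_P l')
      end) l)
  end.

Lemma Pos_dim (B : tree) (k : nat) : dim B < k -> Pos B k -> False.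
Proof.
elim/tree_list_ind: B k => l; elim: l => [|B l IHl] /=; first by move=> _ [].
move=> [IHB IH] [|k] //; rewrite gtn_max => /andP [dB dl].
case: l IHl IH dl => [|B' l] IHl IH dl; first exact: IHB.
by case=> [p|p]; [apply: (IHB k)|apply: (IHl IH k.+1)].
Qed.

Definition disk0_map_cell (X : glob) (x : X 0) (n : nat) : disk0 n -> X n :=
  match n return disk0 n -> X n with
  | 0 => fun=> x
  | _.+1 => fun z : Empty_set => match z with end
  end.

Definition disk0_map (X : glob) (x : X 0) : globhom disk0 X.
Proof. by apply: (@GlobHom disk0 X (disk0_map_cell x)) => n []. Defined.

Fixpoint wedges_map (b : tree -> tree) (h : forall B, globhom (Pos (b B)) (Pos B))
  (l : seq tree) : bglobhom (Pos (br (map b l))) (Pos (br l)) :=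
  match l with
  | [::] => bglobhom_id disk0
  | B :: l' =>
    match l' as l' return bglobhom (Pos (br (map b l'))) (Pos (br l')) ->
      bglobhom (Pos (br (map b (B :: l')))) (Pos (br (B :: l'))) with
    | [::] => fun=> gsusp_map (h B)
    | _ :: _ => fun f => wedge_map (h B) f
    end (wedges_map h l')
  end.

Fixpoint src_incl (k : nat) : forall B, globhom (Pos (bd k B)) (Pos B) :=
  match k with
  | 0 => fun B => disk0_map (bminus (Pos B))
  | k'.+1 => fun B => match B with br l => wedges_map (src_incl k') l end
  end.

Fixpoint tgt_incl (k : nat) : forall B, globhom (Pos (bd k B)) (Pos B) :=
  match k with
  | 0 => fun B => disk0_map (bplus (Pos B))
  | k'.+1 => fun B => match B with br l => wedges_map (tgt_incl k') l end
  end.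

Definition tsusp (B : tree) : tree := br [:: B].

(* The data of the recursion in one dimension: [stage k] lives in dimension
   k - 1, so that the recursion starts in dimension -1 with [k = 0].  [gbdry]
   sends a k-cell of [X] to the sphere of its source and target, and [gens C] is
   the set of the generators of [C] of all dimensions. *)
Record stage (k : nat) := Stage {
  Comp : category;
  Sph : functor Comp TYPE;
  Free : functor GLOB Comp;
  gbdry : forall X : glob, X k -> Sph (Free X);
  gbdry_natural : forall (X Y : glob) (f : globhom X Y) (x : X k),
    fmap Sph (@fmap GLOB Comp Free X Y f) (gbdry x) = gbdry (f k x);
  gbdry_glob : forall (X : glob) (x : X k.+1), gbdry (src x) = gbdry (tgt x);
  gens : Comp -> Type;
  supp_sph : forall C : Comp, Sph C -> gens C -> Prop;
  supp_hom : forall C D : Comp, hom C D -> gens D -> Prop;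
  full : forall B : tree, Sph (Free (Pos B)) -> Prop }.

Arguments Sph {k} s.
Arguments Free {k} s.
Arguments gbdry {k} s {X} x.
Arguments gens {k s} C.
Arguments supp_sph {k s C} A g.
Arguments supp_hom {k s C D} f g.
Arguments full {k} s B A.

Section NextStage.
Variables (n : nat) (S : stage n).

Record ncomp := NComp {
  under : Comp S;
  gen : Type;
  bound : gen -> Sph S under }.

(* The cells are the [precell]s that satisfy [wf]: in a coherence cell
   [precoh B A t tV], the pair of [t] and [tV] has to be a morphism.  The
   boundary of a cell depends on [t] only. *)
Inductive precell (C : ncomp) : Type :=
| prevar of gen C
| precoh (B : tree) (dimB : dim B <= n) (A : Sph S (Free S (Pos B)))
    (fullA : full S B A) (t : hom (Free S (Pos B)) (under C))
    (tV : Pos B n -> precell C).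

Definition prebdry (C : ncomp) (c : precell C) : Sph S (under C) :=
  match c with
  | prevar v => bound v
  | precoh B _ A _ t _ => fmap (Sph S) t A
  end.

Fixpoint wf (C : ncomp) (c : precell C) : Prop :=
  match c with
  | prevar _ => True
  | precoh B _ _ _ t tV => forall p : Pos B n,
      wf (tV p) /\ prebdry (tV p) = fmap (Sph S) t (gbdry S p)
  end.

Definition ncell (C : ncomp) : Type := {c : precell C | wf c}.

Definition nbdry (C : ncomp) (c : ncell C) : Sph S (under C) := prebdry (sval c).

Lemma ncell_eq (C : ncomp) (c d : ncell C) : sval c = sval d -> c = d.
Proof.
case: c d => [c wc] [d wd] /= e; case: d / e wd => wd.
by rewrite (proof_irrelevance _ wc wd).
Qed.

Definition nvar (C : ncomp) (v : gen C) : ncell C :=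
  exist (@wf C) (prevar v) I.

Record nhom (C D : ncomp) := NHom {
  hunder : hom (under C) (under D);
  hgen : gen C -> ncell D;
  hbound : forall v, nbdry (hgen v) = fmap (Sph S) hunder (bound v) }.

Lemma nhom_ext (C D : ncomp) (f g : nhom C D) :
  hunder f = hunder g -> (forall v, hgen f v = hgen g v) -> f = g.
Proof.
case: f g => [f fV fb] [g gV gb] /= e /functional_extensionality eV.
case: g / e gb => gb; case: gV / eV gb => gb.
by rewrite (proof_irrelevance _ fb gb).
Qed.

Lemma precoh_ext (C : ncomp) B dB dB' A fA fA' t t' tV tV' :
  t = t' -> (forall p, tV p = tV' p) ->
  @precoh C B dB A fA t tV = @precoh C B dB' A fA' t' tV'.
Proof.
move=> -> /functional_extensionality ->.
by rewrite (proof_irrelevance _ fA fA') (proof_irrelevance _ dB dB').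
Qed.

Fixpoint preact (C D : ncomp) (f : nhom C D) (c : precell C) : precell D :=
  match c with
  | prevar v => sval (hgen f v)
  | precoh B dB A fA t tV => precoh dB fA (hunder f \oc t) (fun p => preact f (tV p))
  end.

Lemma prebdry_act (C D : ncomp) (f : nhom C D) (c : precell C) :
  prebdry (preact f c) = fmap (Sph S) (hunder f) (prebdry c).
Proof.
case: c => [v|B dB A fA t tV] /=; first exact: hbound.
by rewrite fmap_comp.
Qed.

Lemma wf_act (C D : ncomp) (f : nhom C D) (c : precell C) : wf c -> wf (preact f c).
Proof.
elim: c => [v _|B dB A fA t tV IH w p] /=; first exact: svalP.
case: (w p) => wp bp; split; first exact: IH.
by rewrite prebdry_act bp fmap_comp.
Qed.

Definition nact (C D : ncomp) (f : nhom C D) (c : ncell C) : ncell D :=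
  exist (@wf D) (preact f (sval c)) (wf_act f (svalP c)).

Lemma nbdry_act (C D : ncomp) (f : nhom C D) (c : ncell C) :
  nbdry (nact f c) = fmap (Sph S) (hunder f) (nbdry c).
Proof. exact: prebdry_act. Qed.

Definition nhom_id (C : ncomp) : nhom C C.
Proof. by apply: (@NHom C C (idm _) (@nvar C)) => v; rewrite fmap_id. Defined.

Lemma nhom_comp_proof (C D E : ncomp) (g : nhom D E) (f : nhom C D) v :
  nbdry (nact g (hgen f v)) = fmap (Sph S) (hunder g \oc hunder f) (bound v).
Proof. by rewrite nbdry_act hbound fmap_comp. Qed.

Definition nhom_comp (C D E : ncomp) (g : nhom D E) (f : nhom C D) : nhom C E :=
  NHom (nhom_comp_proof g f).

Lemma nact_id (C : ncomp) (c : ncell C) : nact (nhom_id C) c = c.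
Proof.
case: c => c w; apply: ncell_eq => /= {w}.
elim: c => //= B dB A fA t tV IH; apply: precoh_ext => //; exact: comp1f.
Qed.

Lemma nact_comp (C D E : ncomp) (g : nhom D E) (f : nhom C D) (c : ncell C) :
  nact (nhom_comp g f) c = nact g (nact f c).
Proof.
case: c => c w; apply: ncell_eq => /= {w}.
elim: c => //= B dB A fA t tV IH; apply: precoh_ext => //.
by rewrite compA.
Qed.

Definition NCOMP : category.
Proof.
apply: (@Category ncomp nhom nhom_id nhom_comp).
- by move=> C D f; apply: nhom_ext => [|v]; rewrite /= ?comp1f ?nact_id.
- by move=> C D f; apply: nhom_ext => [|v]; rewrite /= ?compf1 //; apply: ncell_eq.
- by move=> A B C D h g f; apply: nhom_ext => [|v] /=; rewrite ?compA ?nact_comp.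
Defined.

Definition NCell : functor NCOMP TYPE.
Proof.
apply: (@Functor NCOMP TYPE ncell); apply: (@Functoriality NCOMP TYPE _ nact).
- by move=> C; apply: functional_extensionality => c; apply: nact_id.
- by move=> C D E g f; apply: functional_extensionality => c; apply: nact_comp.
Defined.

Record nsph (C : ncomp) := NSph {
  pr1 : ncell C;
  pr2 : ncell C;
  parallel : nbdry pr1 = nbdry pr2 }.

Lemma nsph_ext (C : ncomp) (A A' : nsph C) : pr1 A = pr1 A' -> pr2 A = pr2 A' -> A = A'.
Proof.
case: A A' => [a b p] [a' b' p'] /= ea eb; case: a' / ea p'; case: b' / eb => p'.
by rewrite (proof_irrelevance _ p p').
Qed.

Lemma nsph_act_proof (C D : ncomp) (f : nhom C D) (A : nsph C) :
  nbdry (nact f (pr1 A)) = nbdry (nact f (pr2 A)).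
Proof. by rewrite !nbdry_act parallel. Qed.

Definition nsph_act (C D : ncomp) (f : nhom C D) (A : nsph C) : nsph D :=
  NSph (nsph_act_proof f A).

Definition NSphere : functor NCOMP TYPE.
Proof.
apply: (@Functor NCOMP TYPE nsph); apply: (@Functoriality NCOMP TYPE _ nsph_act).
- by move=> C; apply: functional_extensionality => A; apply: nsph_ext; apply: nact_id.
- by move=> C D E g f; apply: functional_extensionality => A; apply: nsph_ext;
    apply: nact_comp.
Defined.

Definition nfree (X : glob) : ncomp := @NComp (Free S X) (X n) (@gbdry n S X).

Definition nfree_map (X Y : glob) (f : globhom X Y) : nhom (nfree X) (nfree Y).
Proof.
apply: (@NHom (nfree X) (nfree Y) (@fmap GLOB _ (Free S) X Y f)
  (fun x => @nvar (nfree Y) (f n x))) => x.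
by rewrite /= gbdry_natural.
Defined.

Definition NFree : functor GLOB NCOMP.
Proof.
apply: (@Functor GLOB NCOMP nfree); apply: (@Functoriality GLOB NCOMP _ nfree_map).
- by move=> X; apply: nhom_ext => //=; rewrite (fmap_id (Free S) X).
- move=> X Y Z g f; apply: nhom_ext => //= [|x]; first by rewrite -fmap_comp.
  exact: ncell_eq.
Defined.

Definition ngbdry (X : glob) (x : X n.+1) : nsph (nfree X) :=
  @NSph (nfree X) (@nvar (nfree X) (src x)) (@nvar (nfree X) (tgt x)) (gbdry_glob S x).

Lemma ngbdry_natural (X Y : glob) (f : globhom X Y) (x : X n.+1) :
  nsph_act (nfree_map f) (ngbdry x) = ngbdry (f n.+1 x).
Proof. by apply: nsph_ext; apply: ncell_eq; rewrite /= ?gmap_src ?gmap_tgt. Qed.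

Lemma ngbdry_glob (X : glob) (x : X n.+2) : ngbdry (src x) = ngbdry (tgt x).
Proof. by apply: nsph_ext; apply: ncell_eq; rewrite /= ?src_glob ?tgt_glob. Qed.

Definition ngens (C : ncomp) : Type := (gens (under C) + gen C)%type.

Definition from_under (C : ncomp) (P : gens (under C) -> Prop) (g : ngens C) : Prop :=
  match g with inl g => P g | inr _ => False end.

Fixpoint presupp (C : ncomp) (c : precell C) (g : ngens C) : Prop :=
  match c with
  | prevar v => g = inr v \/ from_under (supp_sph (bound v)) g
  | precoh B _ _ _ t tV =>
      from_under (supp_hom t) g \/ exists p : Pos B n, presupp (tV p) g
  end.

Definition nsupp (C : ncomp) (c : ncell C) : ngens C -> Prop := presupp (sval c).

Definition nsupp_sph (C : ncomp) (A : nsph C) (g : ngens C) : Prop :=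
  nsupp (pr1 A) g \/ nsupp (pr2 A) g.

(* The union of the supports of the images of the generators. *)
Definition nsupp_hom (C D : ncomp) (f : nhom C D) (g : ngens D) : Prop :=
  from_under (supp_hom (hunder f)) g \/ exists v, nsupp (hgen f v) g.

(* The generators of [nfree (Pos (bd n B))] are all the positions of [bd n B],
   by [dim_bd] and [Pos_dim]. *)
Definition nfull (B : tree) (A : nsph (nfree (Pos B))) : Prop :=
  exists a b : ncell (nfree (Pos (bd n B))),
    [/\ pr1 A = nact (nfree_map (src_incl n B)) a,
        pr2 A = nact (nfree_map (tgt_incl n B)) b,
        forall g, nsupp a g & forall g, nsupp b g].

Definition next : stage n.+1 :=
  @Stage n.+1 NCOMP NSphere NFree ngbdry ngbdry_natural ngbdry_glob
    ngens nsupp_sph nsupp_hom nfull.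

Definition ncoh (C : ncomp) (B : tree) (dimB : dim B <= n)
    (A : Sph S (Free S (Pos B))) (fullA : full S B A)
    (t : nhom (nfree (Pos B)) C) : ncell C :=
  exist (@wf C)
    (@precoh C B dimB A fullA (hunder t) (fun p => sval (hgen t p)))
    (fun p => conj (svalP (hgen t p)) (hbound t p)).

Lemma nbdry_coh C B dimB A fullA t :
  nbdry (@ncoh C B dimB A fullA t) = fmap (Sph S) (hunder t) A.
Proof. by []. Qed.

Lemma nact_coh C D (f : nhom C D) B dimB A fullA t :
  nact f (@ncoh C B dimB A fullA t) = @ncoh D B dimB A fullA (nhom_comp f t).
Proof. exact: ncell_eq. Qed.

Lemma nact_var C D (f : nhom C D) v : nact f (nvar v) = hgen f v.
Proof. exact: ncell_eq. Qed.

Lemma ncell_ind_coh (C : ncomp) (P : ncell C -> Prop) :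
  (forall v, P (nvar v)) ->
  (forall B dimB A fullA t, (forall p, P (hgen t p)) ->
    P (@ncoh C B dimB A fullA t)) ->
  forall c, P c.
Proof.
move=> Pv Pc [c]; elim: c => [v|B dB A fA t tV IH] w.
  by rewrite (_ : exist _ _ _ = nvar v) //; apply: ncell_eq.
pose tV' p : ncell C := exist (@wf C) (tV p) (proj1 (w p)).
pose t' : nhom (nfree (Pos B)) C :=
  @NHom (nfree (Pos B)) C t tV' (fun p => proj2 (w p)).
rewrite (_ : exist _ _ _ = @ncoh C B dB A fA t'); last exact: ncell_eq.
by apply: Pc => p; apply: IH.
Qed.

End NextStage.

Arguments nvar {n S C} v.

(* Dimension -1.  The (-1)-sphere is not full: there are no coherence 0-cells. *)
Definition stage0 : stage 0 :=
  @Stage 0 ONE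
    (@Functor ONE TYPE (fun=> unit)
      (@Functoriality ONE TYPE (fun=> unit) (fun _ _ _ x => x) (fun=> erefl)
        (fun _ _ _ _ _ => erefl)))
    (@Functor GLOB ONE (fun=> tt)
      (@Functoriality GLOB ONE (fun=> tt) (fun _ _ _ => tt) (fun=> erefl) (fun _ _ _ _ _ => erefl)))
    (fun _ _ => tt) (fun _ _ _ _ => erefl) (fun _ _ => erefl)
    (fun=> Empty_set) (fun _ _ _ => False) (fun _ _ _ _ => False) (fun _ _ => False).

Fixpoint tower (k : nat) : stage k :=
  match k with 0 => stage0 | n.+1 => next (tower n) end.

Lemma fmap_id_app (C : category) (F : functor C TYPE) (a : C) x : fmap F (idm a) x = x.
Proof. by rewrite fmap_id. Qed.

Lemma fmap_comp_app (C : category) (F : functor C TYPE) (a b c : C) (g : hom b c)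
  (f : hom a b) x : fmap F (g \oc f) x = fmap F g (fmap F f x).
Proof. by rewrite fmap_comp. Qed.

(* [trunc C k] is the truncation of [C] to dimension k - 1, as in [stage]. *)
Record computad := Computad {
  trunc :> forall k, Comp (tower k);
  trunc_under : forall k,
    @under k (tower k) (trunc k.+1) = trunc k :> Comp (tower k) }.

Definition tunder (C : computad) (k : nat) : Comp (tower k) :=
  @under k (tower k) (trunc C k.+1).

Definition tie (C : computad) (k : nat) : hom (tunder C k) (trunc C k) :=
  idto (trunc_under C k).

Definition tie_inv (C : computad) (k : nat) : hom (trunc C k) (tunder C k) :=
  idto (esym (trunc_under C k)).

Lemma tieK (C : computad) k : tie_inv C k \oc tie C k = idm _.
Proof. exact: idtoK. Qed.

Lemma tie_invK (C : computad) k : tie C k \oc tie_inv C k = idm _.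
Proof. exact: idtoK. Qed.

Definition thunder (C D : computad) (k : nat)
  (f : hom (trunc C k.+1) (trunc D k.+1)) : hom (tunder C k) (tunder D k) :=
  @hunder k (tower k) (trunc C k.+1) (trunc D k.+1) f.

Record comphom (C D : computad) := CompHom {
  htrunc :> forall k, hom (trunc C k) (trunc D k);
  htrunc_under : forall k,
    tie D k \oc thunder (htrunc k.+1) = htrunc k \oc tie C k }.

Lemma comphom_ext (C D : computad) (f g : comphom C D) : (forall k, f k = g k) -> f = g.
Proof.
case: f g => [f fu] [g gu] /= fg.
have e : f = g by apply: functional_extensionality_dep.
by case: g / e gu {fg} => gu; rewrite (proof_irrelevance _ fu gu).
Qed.

Definition comphom_id (C : computad) : comphom C C.
Proof.
by apply: (@CompHom C C (fun k => idm (trunc C k))) => k; rewrite [LHS]compf1 comp1f.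
Defined.

Definition comphom_comp (C D E : computad) (g : comphom D E) (f : comphom C D) :
  comphom C E.
Proof.
apply: (@CompHom C E (fun k => g k \oc f k)) => k.
rewrite -compA -htrunc_under compA -htrunc_under -compA.
by congr (_ \oc _).
Defined.

Definition COMP : category.
Proof.
apply: (@Category computad comphom comphom_id comphom_comp) => *;
  apply: comphom_ext => k /=.
- exact: comp1f.
- exact: compf1.
- exact: compA.
Defined.

(* The n-cells; their boundary, an (n-1)-sphere, is moved from
   [under (trunc C n.+1)] to [trunc C n]. *)
Definition Cells (C : computad) (n : nat) : Type := @ncell n (tower n) (trunc C n.+1).

Definition cbdry (C : computad) (n : nat) (c : Cells C n) : Sph (tower n) (trunc C n) :=
  fmap (Sph (tower n)) (tie C n) (@nbdry n (tower n) (trunc C n.+1) c).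

Definition csrc (C : computad) (n : nat) (c : Cells C n.+1) : Cells C n :=
  @pr1 n (tower n) (trunc C n.+1) (cbdry c).

Definition ctgt (C : computad) (n : nat) (c : Cells C n.+1) : Cells C n :=
  @pr2 n (tower n) (trunc C n.+1) (cbdry c).

Lemma cbdry_glob (C : computad) n (c : Cells C n.+1) : cbdry (csrc c) = cbdry (ctgt c).
Proof. by rewrite /cbdry (parallel (cbdry c : @nsph n (tower n) _)). Qed.

Definition Cell (C : computad) : glob.
Proof.
apply: (@Glob (Cells C) (@csrc C) (@ctgt C)) => n x; rewrite /csrc /ctgt.
- by rewrite (cbdry_glob x).
- by rewrite (cbdry_glob x).
Defined.

Definition cact (C D : computad) (f : comphom C D) (n : nat) (c : Cells C n) : Cells D n :=
  @nact n (tower n) (trunc C n.+1) (trunc D n.+1) (f n.+1) c.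

Lemma cbdry_act (C D : computad) (f : comphom C D) n (c : Cells C n) :
  cbdry (cact f c) = fmap (Sph (tower n)) (f n) (cbdry c).
Proof.
rewrite /cbdry nbdry_act.
have /(congr1 (fun h => fmap (Sph (tower n)) h (nbdry c))) := htrunc_under f n.
by rewrite !fmap_comp.
Qed.

Definition Cell_map (C D : computad) (f : comphom C D) : globhom (Cell C) (Cell D).
Proof.
apply: (@GlobHom (Cell C) (Cell D) (@cact C D f)) => n x /=.
- by rewrite /csrc cbdry_act.
- by rewrite /ctgt cbdry_act.
Defined.

Definition CELL : functor COMP GLOB.
Proof.
apply: (@Functor COMP GLOB Cell); apply: (@Functoriality COMP GLOB _ Cell_map).
- by move=> C; apply: globhom_ext => n x; apply: nact_id.
- by move=> C D E g f; apply: globhom_ext => n x; apply: nact_comp.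
Defined.

Definition FreeC (X : glob) : computad :=
  @Computad (fun k => Free (tower k) X) (fun=> erefl).

Definition FreeC_map (X Y : glob) (f : globhom X Y) : comphom (FreeC X) (FreeC Y).
Proof.
apply: (@CompHom (FreeC X) (FreeC Y) (fun k => @fmap GLOB _ (Free (tower k)) X Y f)) => k.
by rewrite [LHS]comp1f [RHS]compf1.
Defined.

Definition FREE : functor GLOB COMP.
Proof.
apply: (@Functor GLOB COMP FreeC); apply: (@Functoriality GLOB COMP _ FreeC_map).
- by move=> X; apply: comphom_ext => k; apply: (fmap_id (Free (tower k)) X).
- move=> X Y Z g f; apply: comphom_ext => k.
  exact: (@fmap_comp GLOB _ (Free (tower k)) X Y Z g f).
Defined.

Lemma cbdry_var (X : glob) n (x : X n) :
  @cbdry (FreeC X) n (@nvar n (tower n) (Free (tower n.+1) X) x) = gbdry (tower n) x.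
Proof. exact (@fmap_id_app _ (Sph (tower n)) (Free (tower n) X) (gbdry (tower n) x)). Qed.

Definition geta (X : glob) : globhom X (Cell (FreeC X)).
Proof.
apply: (@GlobHom X (Cell (FreeC X))
  (fun n x => @nvar n (tower n) (Free (tower n.+1) X) x)) => n x /=.
- by rewrite /csrc cbdry_var.
- by rewrite /ctgt cbdry_var.
Defined.

Definition ceps_inv (C : computad) (k : nat)
  (e : hom (Free (tower k) (Cell C)) (trunc C k)) : Prop :=
  forall c : Cells C k, fmap (Sph (tower k)) e (@gbdry k (tower k) (Cell C) c) = cbdry c.

Lemma ceps_bound (C : computad) n (e : hom (Free (tower n) (Cell C)) (trunc C n)) :
  ceps_inv e -> forall c : Cells C n,
  @nbdry n (tower n) (trunc C n.+1) c =
  fmap (Sph (tower n)) (tie_inv C n \oc e) (@gbdry n (tower n) (Cell C) c).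
Proof. by move=> he c; rewrite fmap_comp /= he -[RHS]fmap_comp_app tieK fmap_id. Qed.

Definition ceps_next (C : computad) (n : nat)
    (e : hom (Free (tower n) (Cell C)) (trunc C n)) (he : ceps_inv e) :
    hom (Free (tower n.+1) (Cell C)) (trunc C n.+1) :=
  @NHom n (tower n) (Free (tower n.+1) (Cell C)) (trunc C n.+1)
    (tie_inv C n \oc e) id (ceps_bound he).

Lemma ceps_next_inv (C : computad) n (e : hom (Free (tower n) (Cell C)) (trunc C n))
  (he : ceps_inv e) : ceps_inv (ceps_next he).
Proof. by move=> c; apply: nsph_ext; rewrite /= nact_var. Qed.

Lemma ceps_inv0 (C : computad) (e : hom (Free (tower 0) (Cell C)) (trunc C 0)) :
  ceps_inv e.
Proof. by move=> c; case: (cbdry c). Qed.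

Fixpoint ceps_rec (C : computad) (k : nat) :
    {e : hom (Free (tower k) (Cell C)) (trunc C k) | ceps_inv e} :=
  match k with
  | 0 => exist _ (tt : hom (Free (tower 0) (Cell C)) (trunc C 0)) (@ceps_inv0 C tt)
  | n.+1 => exist _ (ceps_next (svalP (ceps_rec C n))) (ceps_next_inv (svalP (ceps_rec C n)))
  end.

(* The counit, given by the identity on generators. *)
Definition ceps (C : computad) : comphom (FreeC (Cell C)) C.
Proof.
apply: (@CompHom (FreeC (Cell C)) C (fun k => sval (ceps_rec C k))) => k.
by rewrite [RHS]compf1 /thunder /= compA tie_invK comp1f.
Defined.

Definition chgen (C D : computad) (f : comphom C D) (n : nat)
  (v : @gen n (tower n) (trunc C n.+1)) : Cells D n :=
  @hgen n (tower n) (trunc C n.+1) (trunc D n.+1) (f n.+1) v.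

Lemma comphom_gen_ext (C D : computad) (f g : comphom C D) :
  (forall n (v : @gen n (tower n) (trunc C n.+1)), chgen f v = chgen g v) -> f = g.
Proof.
move=> fg; apply: comphom_ext; elim=> [|k IH].
  by case: (f 0) (g 0) => -[].
apply: nhom_ext => [|v]; last exact: fg.
rewrite -[LHS]comp1f -[RHS]comp1f -(tieK D k) -!compA.
have := htrunc_under f k; have := htrunc_under g k.
by rewrite /thunder IH => -> ->.
Qed.

Lemma ceps_natural (C D : computad) (f : comphom C D) :
  comphom_comp f (ceps C) = comphom_comp (ceps D) (FreeC_map (Cell_map f)).
Proof.
by apply: comphom_gen_ext => n v; rewrite /chgen /= !nact_var.
Qed.

Definition T : functor GLOB GLOB := fcomp CELL FREE.

Definition Tmap (X Y : glob) (f : globhom X Y) : globhom (T X) (T Y) := fmap T f.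

Lemma Tmap_id (X : glob) : Tmap (globhom_id X) = globhom_id (T X).
Proof. exact: (fmap_id T X). Qed.

Lemma Tmap_comp (X Y Z : glob) (g : globhom Y Z) (f : globhom X Y) :
  Tmap (globhom_comp g f) = globhom_comp (Tmap g) (Tmap f).
Proof. exact: (@fmap_comp _ _ T X Y Z g f). Qed.

Lemma Cell_map_comp (C D E : computad) (g : comphom D E) (f : comphom C D) :
  Cell_map (comphom_comp g f) = globhom_comp (Cell_map g) (Cell_map f).
Proof. exact: (@fmap_comp _ _ CELL C D E g f). Qed.

Definition gmu (X : glob) : globhom (T (T X)) (T X) := Cell_map (ceps (FreeC X)).

Record omegacat := OmegaCat {
  oglob :> glob;
  ostr : globhom (T oglob) oglob;
  ostr_unit : globhom_comp ostr (geta oglob) = globhom_id oglob;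
  ostr_mult : globhom_comp ostr (Tmap ostr) = globhom_comp ostr (gmu oglob) }.

Record omegahom (X Y : omegacat) := OmegaHom {
  ohom :> globhom X Y;
  ohom_str : globhom_comp ohom (ostr X) = globhom_comp (ostr Y) (Tmap ohom) }.

Lemma omegahom_ext (X Y : omegacat) (f g : omegahom X Y) : ohom f = ohom g -> f = g.
Proof.
case: f g => [f fs] [g gs] /= e; case: g / e gs => gs.
by rewrite (proof_irrelevance _ fs gs).
Qed.

Lemma omegahom_id_proof (X : omegacat) :
  globhom_comp (globhom_id X) (ostr X) = globhom_comp (ostr X) (Tmap (globhom_id X)).
Proof. by rewrite Tmap_id; apply: globhom_ext. Qed.

Definition omegahom_id (X : omegacat) : omegahom X X := OmegaHom (omegahom_id_proof X).

Lemma omegahom_comp_proof (X Y Z : omegacat) (g : omegahom Y Z) (f : omegahom X Y) :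
  globhom_comp (globhom_comp g f) (ostr X) =
  globhom_comp (ostr Z) (Tmap (globhom_comp g f)).
Proof.
rewrite Tmap_comp; transitivity (globhom_comp g (globhom_comp f (ostr X))).
  exact: globhom_ext.
rewrite ohom_str; transitivity (globhom_comp (globhom_comp g (ostr Y)) (Tmap f)).
  exact: globhom_ext.
by rewrite ohom_str; apply: globhom_ext.
Qed.

Definition omegahom_comp (X Y Z : omegacat) (g : omegahom Y Z) (f : omegahom X Y) :
  omegahom X Z := OmegaHom (omegahom_comp_proof g f).

Definition OMEGACAT : category.
Proof.
by apply: (@Category omegacat omegahom omegahom_id omegahom_comp) => *;
  apply: omegahom_ext; apply: globhom_ext.
Defined.

Definition KTob (C : computad) : omegacat.
Proof.
apply: (@OmegaCat (Cell C) (Cell_map (ceps C))).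
- by apply: globhom_ext => n x; apply: nact_var.
- by rewrite /gmu -[RHS]Cell_map_comp ceps_natural Cell_map_comp.
Defined.

Definition KTmap (C D : computad) (f : comphom C D) : omegahom (KTob C) (KTob D).
Proof.
apply: (@OmegaHom (KTob C) (KTob D) (Cell_map f)).
by rewrite [LHS](esym (Cell_map_comp f (ceps C))) ceps_natural Cell_map_comp.
Defined.

Definition KT : functor COMP OMEGACAT.
Proof.
apply: (@Functor COMP OMEGACAT KTob); apply: (@Functoriality COMP OMEGACAT _ KTmap).
- by move=> C; apply: omegahom_ext; apply: (fmap_id CELL C).
- by move=> C D E g f; apply: omegahom_ext; apply: (fmap_comp CELL g f).
Defined.

Record bcomputad := BComputad {
  bcomp :> computad;
  bcminus : Cells bcomp 0;
  bcplus : Cells bcomp 0 }.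

Arguments bcminus : clear implicits.
Arguments bcplus : clear implicits.

Record bcomphom (C D : bcomputad) := BCompHom {
  bchom :> comphom C D;
  bchom_minus : cact bchom (bcminus C) = bcminus D;
  bchom_plus : cact bchom (bcplus C) = bcplus D }.

Lemma bcomphom_ext (C D : bcomputad) (f g : bcomphom C D) : bchom f = bchom g -> f = g.
Proof.
case: f g => [f fm fp] [g gm gp] /= e; case: g / e gm gp => gm gp.
by rewrite (proof_irrelevance _ fm gm) (proof_irrelevance _ fp gp).
Qed.

Definition bcomphom_id (C : bcomputad) : bcomphom C C :=
  @BCompHom C C (comphom_id C) (nact_id _) (nact_id _).

Definition bcomphom_comp (C D E : bcomputad) (g : bcomphom D E) (f : bcomphom C D) :
  bcomphom C E.
Proof.
apply: (@BCompHom C E (comphom_comp g f)).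
- by rewrite -(bchom_minus g) -(bchom_minus f); apply: nact_comp.
- by rewrite -(bchom_plus g) -(bchom_plus f); apply: nact_comp.
Defined.

Definition BCOMP : category.
Proof.
apply: (@Category bcomputad bcomphom bcomphom_id bcomphom_comp) => *;
  apply: bcomphom_ext.
- exact: (@comp1f COMP).
- exact: (@compf1 COMP).
- exact: (@compA COMP).
Defined.

Definition bCell (C : bcomputad) : bglob := @BGlob (Cell C) (bcminus C) (bcplus C).

Definition bCell_map (C D : bcomputad) (f : bcomphom C D) : bglobhom (bCell C) (bCell D) :=
  @BGlobHom (bCell C) (bCell D) (Cell_map f) (bchom_minus f) (bchom_plus f).

Definition BCELL : functor BCOMP BGLOB.
Proof.
apply: (@Functor BCOMP BGLOB bCell); apply: (@Functoriality BCOMP BGLOB _ bCell_map).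
- by move=> C; apply: bglobhom_ext => n x; apply: nact_id.
- by move=> C D E g f; apply: bglobhom_ext => n x; apply: nact_comp.
Defined.

Definition bFree (X : bglob) : bcomputad :=
  @BComputad (FreeC X) (geta X 0 (bminus X)) (geta X 0 (bplus X)).

Lemma bFree_map_proof (X Y : bglob) (f : bglobhom X Y) (x : X 0) (y : Y 0) :
  f 0 x = y -> cact (FreeC_map f) (geta X 0 x) = geta Y 0 y.
Proof. by move=> <-; apply: nact_var. Qed.

Definition bFree_map (X Y : bglob) (f : bglobhom X Y) : bcomphom (bFree X) (bFree Y) :=
  @BCompHom (bFree X) (bFree Y) (FreeC_map f)
    (bFree_map_proof (bglobhom_minus f)) (bFree_map_proof (bglobhom_plus f)).

Definition BFREE : functor BGLOB BCOMP.
Proof.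
apply: (@Functor BGLOB BCOMP bFree); apply: (@Functoriality BGLOB BCOMP _ bFree_map).
- by move=> X; apply: bcomphom_ext; apply: (fmap_id FREE (X : glob)).
- move=> X Y Z g f; apply: bcomphom_ext.
  exact: (@fmap_comp _ _ FREE _ _ _ (g : globhom Y Z) (f : globhom X Y)).
Defined.

Definition bT : functor BGLOB BGLOB := fcomp BCELL BFREE.

Record bomegacat := BOmegaCat {
  bocat :> omegacat;
  bominus : bocat 0;
  boplus : bocat 0 }.

Arguments bominus : clear implicits.
Arguments boplus : clear implicits.

Record bomegahom (X Y : bomegacat) := BOmegaHom {
  bohom :> omegahom X Y;
  bohom_minus : bohom 0 (bominus X) = bominus Y;
  bohom_plus : bohom 0 (boplus X) = boplus Y }.

Lemma bomegahom_ext (X Y : bomegacat) (f g : bomegahom X Y) : ohom f = ohom g -> f = g.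
Proof.
case: f g => [f fm fp] [g gm gp] /= /(@omegahom_ext _ _ f g) e.
case: g / e gm gp => gm gp.
by rewrite (proof_irrelevance _ fm gm) (proof_irrelevance _ fp gp).
Qed.

Definition bomegahom_id (X : bomegacat) : bomegahom X X :=
  @BOmegaHom X X (omegahom_id X) erefl erefl.

Definition bomegahom_comp (X Y Z : bomegacat) (g : bomegahom Y Z) (f : bomegahom X Y) :
  bomegahom X Z.
Proof.
by apply: (@BOmegaHom X Z (omegahom_comp g f));
  rewrite /= ?bohom_minus ?bohom_plus.
Defined.

Definition BOMEGACAT : category.
Proof.
by apply: (@Category bomegacat bomegahom bomegahom_id bomegahom_comp) => *;
  apply: bomegahom_ext; apply: globhom_ext.
Defined.

Definition bKTob (C : bcomputad) : bomegacat :=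
  @BOmegaCat (KTob C) (bcminus C) (bcplus C).

Definition bKTmap (C D : bcomputad) (f : bcomphom C D) : bomegahom (bKTob C) (bKTob D) :=
  @BOmegaHom (bKTob C) (bKTob D) (KTmap f) (bchom_minus f) (bchom_plus f).

Definition BKT : functor BCOMP BOMEGACAT.
Proof.
apply: (@Functor BCOMP BOMEGACAT bKTob);
  apply: (@Functoriality BCOMP BOMEGACAT _ bKTmap).
- by move=> C; apply: bomegahom_ext; apply: (fmap_id CELL (C : computad)).
- move=> C D E g f; apply: bomegahom_ext.
  exact: (@fmap_comp _ _ CELL _ _ _ (g : comphom D E) (f : comphom C D)).
Defined.

Lemma supp_hom_idto k (S : stage k) (C C' D : Comp S) (e : C = C') (f : hom C' D) :
  supp_hom (f \oc idto e) = supp_hom f.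
Proof. by case: C' / e f => f; rewrite compf1. Qed.

(* The suspension from one dimension to the next.  A generator of [So C] is
   either a basepoint or a generator of [C], which [Sgens] tells apart. *)
Record suspdata (k : nat) (S : stage k) (S' : stage k.+1) := SuspData {
  So : functor (Comp S) (Comp S');
  Ssph : forall C : Comp S, Sph S C -> Sph S' (So C);
  Ssph_natural : forall (C D : Comp S) (f : hom C D) (A : Sph S C),
    Ssph (fmap (Sph S) f A) = fmap (Sph S') (fmap So f) (Ssph A);
  SFree : forall X : glob, So (Free S X) = Free S' (gsusp X);
  SFree_natural : forall (X Y : glob) (f : globhom X Y),
    idto (SFree Y) \oc fmap So (@fmap GLOB _ (Free S) X Y f) =
    @fmap GLOB _ (Free S') (gsusp X) (gsusp Y) (gsusp_map f) \oc idto (SFree X);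
  Sgbdry : forall (X : glob) (x : X k),
    fmap (Sph S') (idto (SFree X)) (Ssph (gbdry S x)) = @gbdry k.+1 S' (gsusp X) x;
  Sgens : forall C : Comp S, gens (So C) -> option (gens C);
  Ssupp_sph : forall (C : Comp S) (A : Sph S C) (g : gens (So C)),
    (forall g0, Sgens g = Some g0 -> supp_sph A g0) -> supp_sph (Ssph A) g;
  Ssupp_hom : forall (C D : Comp S) (f : hom C D) (g : gens (So D)),
    (forall g0, Sgens g = Some g0 -> supp_hom f g0) -> supp_hom (fmap So f) g;
  Sfull : forall (B : tree) (A : Sph S (Free S (Pos B))), full S B A ->
    full S' (tsusp B) (fmap (Sph S') (idto (SFree (Pos B))) (Ssph A)) }.

Arguments So {k S S'} s.
Arguments Ssph {k S S'} s {C} A.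
Arguments SFree {k S S'} s X.
Arguments Sgens {k S S'} s {C} g.

Lemma dim_tsusp B n : dim B <= n -> dim (tsusp B) <= n.+1.
Proof. by rewrite /= maxn0. Qed.

Lemma ncomp_eq n (S : stage n) (C D : Comp S) (V : Type) (b : V -> Sph S C)
  (b' : V -> Sph S D) (e : C = D) :
  (forall v, fmap (Sph S) (idto e) (b v) = b' v) -> NComp b = NComp b'.
Proof.
case: D / e b' => b' bb'; congr NComp; apply: functional_extensionality => v.
by rewrite -bb' fmap_id.
Qed.

Lemma idto_ncomp n (S : stage n) (C D : Comp S) (V : Type) (b : V -> Sph S C)
  (b' : V -> Sph S D) (e : C = D) (E : NComp b = NComp b' :> NCOMP S) :
  (forall v, fmap (Sph S) (idto e) (b v) = b' v) ->
  hunder (idto E) = idto e /\ forall v, hgen (idto E) v = @nvar _ _ (NComp b') v.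
Proof.
case: D / e b' E => b' E bb'.
have e : b = b' by apply: functional_extensionality => v; rewrite -bb' fmap_id.
by case: b' / e E {bb'} => E; rewrite idto_id.
Qed.

Section NextSuspension.
Variables (n : nat) (S : stage n) (S' : stage n.+1) (D : suspdata S S').

Definition nsusp (C : ncomp S) : ncomp S' :=
  @NComp _ S' (So D (under C)) (gen C) (fun v => Ssph D (bound v)).

Fixpoint presusp (C : ncomp S) (c : precell C) : precell (nsusp C) :=
  match c with
  | prevar v => @prevar _ S' (nsusp C) v
  | precoh B dB A fA t tV =>
      @precoh _ S' (nsusp C) (tsusp B) (dim_tsusp dB)
        (fmap (Sph S') (idto (SFree D (Pos B))) (Ssph D A)) (Sfull D fA)
        (fmap (So D) t \oc idto (esym (SFree D (Pos B)))) (fun p => presusp (tV p))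
  end.

Lemma SFreeK X (A : Sph S' (So D (Free S X))) :
  fmap (Sph S') (idto (esym (SFree D X))) (fmap (Sph S') (idto (SFree D X)) A) = A.
Proof. by rewrite -fmap_comp_app idtoK fmap_id. Qed.

Lemma prebdry_susp (C : ncomp S) (c : precell C) :
  prebdry (presusp c) = Ssph D (prebdry c).
Proof.
by case: c => [v|B dB A fA t tV] //=; rewrite fmap_comp_app SFreeK Ssph_natural.
Qed.

Lemma wf_susp (C : ncomp S) (c : precell C) : wf c -> wf (presusp c).
Proof.
elim: c => [v _|B dB A fA t tV IH w p] //=; case: (w p) => wp bp.
split; first exact: IH.
rewrite prebdry_susp bp Ssph_natural fmap_comp_app.
by rewrite -(@Sgbdry _ _ _ D (Pos B) p) SFreeK.
Qed.

Definition ncell_susp (C : ncomp S) (c : ncell C) : ncell (nsusp C) :=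
  exist (@wf _ S' (nsusp C)) (presusp (sval c)) (wf_susp (svalP c)).

Lemma nbdry_susp (C : ncomp S) (c : ncell C) : nbdry (ncell_susp c) = Ssph D (nbdry c).
Proof. exact: prebdry_susp. Qed.

Lemma nsusp_map_proof (C E : ncomp S) (f : nhom C E) v :
  nbdry (ncell_susp (hgen f v)) = fmap (Sph S') (fmap (So D) (hunder f)) (Ssph D (bound v)).
Proof. by rewrite nbdry_susp hbound Ssph_natural. Qed.

Definition nsusp_map (C E : ncomp S) (f : nhom C E) : nhom (nsusp C) (nsusp E) :=
  @NHom _ S' (nsusp C) (nsusp E) (fmap (So D) (hunder f))
    (fun v => ncell_susp (hgen f v)) (nsusp_map_proof f).

Lemma ncell_susp_var (C : ncomp S) (v : gen C) :
  ncell_susp (nvar v) = @nvar _ _ (nsusp C) v.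
Proof. exact: ncell_eq. Qed.

Lemma ncell_susp_act (C E : ncomp S) (f : nhom C E) (c : ncell C) :
  ncell_susp (nact f c) = nact (nsusp_map f) (ncell_susp c).
Proof.
case: c => c w; apply: ncell_eq => /= {w}.
elim: c => //= B dB A fA t tV IH; apply: precoh_ext => //.
by rewrite fmap_comp compA.
Qed.

Definition NSUSP : functor (NCOMP S) (NCOMP S').
Proof.
apply: (@Functor (NCOMP S) (NCOMP S') nsusp);
  apply: (@Functoriality (NCOMP S) (NCOMP S') _ nsusp_map).
- move=> C; apply: nhom_ext => /= [|v]; first exact: fmap_id.
  exact: ncell_eq.
- move=> C E F g f; apply: nhom_ext => /= [|v]; first exact: fmap_comp.
  exact: ncell_susp_act.
Defined.

Lemma nsph_susp_proof (C : ncomp S) (A : nsph C) :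
  nbdry (ncell_susp (pr1 A)) = nbdry (ncell_susp (pr2 A)).
Proof. by rewrite !nbdry_susp parallel. Qed.

Definition nsph_susp (C : ncomp S) (A : nsph C) : nsph (nsusp C) :=
  NSph (nsph_susp_proof A).

Lemma nsph_susp_natural (C E : ncomp S) (f : nhom C E) (A : nsph C) :
  nsph_susp (nsph_act f A) = nsph_act (nsusp_map f) (nsph_susp A).
Proof. by apply: nsph_ext; apply: ncell_susp_act. Qed.

Lemma nsusp_free (X : glob) : nsusp (nfree S X) = nfree S' (gsusp X).
Proof. exact: (ncomp_eq (@Sgbdry _ _ _ D X)). Qed.

Definition nfree_iso (X : glob) : nhom (nsusp (nfree S X)) (nfree S' (gsusp X)) :=
  @idto (NCOMP S') _ _ (nsusp_free X).

Lemma nfree_iso_under (X : glob) : hunder (nfree_iso X) = idto (SFree D X).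
Proof. by case: (idto_ncomp (nsusp_free X) (@Sgbdry _ _ _ D X)). Qed.

Lemma nfree_iso_gen (X : glob) (x : X n) :
  hgen (nfree_iso X) x = @nvar _ _ (nfree S' (gsusp X)) x.
Proof. by case: (idto_ncomp (nsusp_free X) (@Sgbdry _ _ _ D X)) => _ ->. Qed.

Lemma nfree_iso_natural (X Y : glob) (f : globhom X Y) :
  nhom_comp (nfree_iso Y) (nsusp_map (nfree_map S f)) =
  nhom_comp (nfree_map S' (gsusp_map f)) (nfree_iso X).
Proof.
apply: nhom_ext => [|x].
  by rewrite /= !nfree_iso_under SFree_natural.
rewrite /= ncell_susp_var nact_var (@nfree_iso_gen X x) nact_var.
exact: (@nfree_iso_gen Y (f n x)).
Qed.

Lemma nfree_iso_gbdry (X : glob) (x : X n.+1) :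
  nsph_act (nfree_iso X) (nsph_susp (ngbdry S x)) = @ngbdry _ S' (gsusp X) x.
Proof.
apply: nsph_ext; rewrite /= ncell_susp_var nact_var.
- exact: (@nfree_iso_gen X (src x)).
- exact: (@nfree_iso_gen X (tgt x)).
Qed.

Definition nsusp_gens (C : ncomp S) (g : ngens (nsusp C)) : option (ngens C) :=
  match g with inl g => omap inl (Sgens D g) | inr v => Some (inr v) end.

Lemma presupp_susp (C : ncomp S) (c : precell C) (g : ngens (nsusp C)) :
  (forall g0, nsusp_gens g = Some g0 -> presupp c g0) -> presupp (presusp c) g.
Proof.
elim: c g => [v|B dB A fA t tV IH] g /= h.
- case: g h => [g|v'] h.
    right; apply: Ssupp_sph => g0 e.
    by case: (h (inl g0)); rewrite /= ?e.
  by case: (h _ erefl) => // -[->]; left.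
- case: g h => [g|v] /= h.
    case e : (Sgens D g) h => [g0|] h.
      case: (h _ erefl) => [s|[p s]]; [left|right].
        rewrite /= supp_hom_idto; apply: Ssupp_hom => g1.
        by rewrite e => -[<-].
      by exists p; apply: IH => g1; rewrite /= e => -[<-].
    by left; rewrite supp_hom_idto; apply: Ssupp_hom => g1; rewrite e.
  case: (h _ erefl) => // -[p s]; right; exists p.
  by apply: IH => g1 [<-].
Qed.

Lemma nsupp_sph_susp (C : ncomp S) (A : nsph C) (g : ngens (nsusp C)) :
  (forall g0, nsusp_gens g = Some g0 -> nsupp_sph A g0) -> nsupp_sph (nsph_susp A) g.
Proof.
case e : (nsusp_gens g) => [g0|] h.
  by case: (h _ erefl) => s; [left|right]; apply: presupp_susp => g1;
    rewrite e => -[<-].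
by left; apply: presupp_susp => g1; rewrite e.
Qed.

Lemma nsupp_hom_susp (C E : ncomp S) (f : nhom C E) (g : ngens (nsusp E)) :
  (forall g0, nsusp_gens g = Some g0 -> nsupp_hom f g0) -> nsupp_hom (nsusp_map f) g.
Proof.
case: g => [g|v] /= h.
  case e : (Sgens D g) h => [g0|] h.
    case: (h _ erefl) => [s|[v s]]; [left|right].
      by apply: Ssupp_hom => g1; rewrite e => -[<-].
    by exists v; apply: presupp_susp => g1; rewrite /= e => -[<-].
  by left; apply: Ssupp_hom => g1; rewrite e.
case: (h _ erefl) => // -[w s]; right; exists w.
by apply: presupp_susp => g1 [<-].
Qed.

Lemma nsupp_idto (C E : ncomp S') (e : C = E) (c : ncell C) :
  (forall g, nsupp c g) -> forall g, nsupp (nact (@idto (NCOMP S') _ _ e) c) g.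
Proof. by case: E / e => h g; rewrite nact_id. Qed.

Lemma nfull_susp (B : tree) (A : nsph (nfree S (Pos B))) :
  nfull A -> @nfull _ S' (tsusp B) (nsph_act (nfree_iso (Pos B)) (nsph_susp A)).
Proof.
have nat X Y (f : globhom X Y) (c : ncell (nfree S X)) :
    nact (nfree_iso Y) (ncell_susp (nact (nfree_map S f) c)) =
    nact (nfree_map S' (gsusp_map f)) (nact (nfree_iso X) (ncell_susp c)).
  by rewrite ncell_susp_act -!nact_comp nfree_iso_natural.
move=> [a [b [Ea Eb sa sb]]].
exists (nact (nfree_iso (Pos (bd n B))) (ncell_susp a)).
exists (nact (nfree_iso (Pos (bd n B))) (ncell_susp b)); split.
- by rewrite /= Ea nat.
- by rewrite /= Eb nat.
- by apply: nsupp_idto => g; apply: presupp_susp => g0 _; apply: sa.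
- by apply: nsupp_idto => g; apply: presupp_susp => g0 _; apply: sb.
Qed.

Definition susp_next : suspdata (next S) (next S') :=
  @SuspData n.+1 (next S) (next S') NSUSP nsph_susp nsph_susp_natural
    nsusp_free nfree_iso_natural nfree_iso_gbdry
    nsusp_gens nsupp_sph_susp nsupp_hom_susp nfull_susp.

End NextSuspension.

(* The (-1)-computad is sent to the 0-computad with the two generators v_- and v_+. *)
Definition susp_pt : ncomp stage0 := @NComp 0 stage0 tt bool (fun=> tt).

Definition susp_pt_sph : nsph susp_pt :=
  @NSph 0 stage0 susp_pt (@nvar 0 stage0 susp_pt false) (@nvar 0 stage0 susp_pt true) erefl.

Definition SUSP0 : functor ONE (NCOMP stage0) :=
  @Functor ONE (NCOMP stage0) (fun=> susp_pt)
    (@Functoriality ONE (NCOMP stage0) (fun=> susp_pt)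
      (fun _ _ _ => nhom_id susp_pt) (fun=> erefl)
      (fun _ _ _ _ _ => esym (@comp1f (NCOMP stage0) _ _ (nhom_id susp_pt)))).

Definition susp0 : suspdata stage0 (next stage0).
Proof.
apply: (@SuspData 0 stage0 (next stage0) SUSP0 (fun _ _ => susp_pt_sph)
  _ (fun=> erefl) _ _ (fun _ _ => None)) => //=.
- by move=> C D f A; apply: nsph_ext; apply: ncell_eq.
- move=> X Y f; apply: nhom_ext => // v.
  exact: ncell_eq.
- by move=> X x; apply: nsph_ext; apply: ncell_eq.
- by move=> C A [[]|[]] _; [right|left]; left.
- by move=> C D f [[]|v] _; right; exists v; left.
Defined.

Fixpoint susp (k : nat) : suspdata (tower k) (tower k.+1) :=
  match k with 0 => susp0 | n.+1 => susp_next (susp n) end.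

Definition suspc_trunc (C : computad) (k : nat) : Comp (tower k) :=
  match k with 0 => tt | n.+1 => So (susp n) (trunc C n) end.

Definition suspc_under (C : computad) (k : nat) :
    @under k (tower k) (suspc_trunc C k.+1) = suspc_trunc C k :> Comp (tower k) :=
  match k with
  | 0 => erefl
  | n.+1 => congr1 (So (susp n)) (trunc_under C n)
  end.

Definition SuspC (C : computad) : computad := Computad (suspc_under C).

Definition suspc_map (C D : computad) (f : comphom C D) (k : nat) :
    hom (suspc_trunc C k) (suspc_trunc D k) :=
  match k with 0 => tt | n.+1 => fmap (So (susp n)) (f n) end.

Lemma tie_susp (C : computad) n : tie (SuspC C) n.+1 = fmap (So (susp n)) (tie C n).
Proof. by rewrite [RHS]fmap_idto. Qed.

Definition SuspC_map (C D : computad) (f : comphom C D) : comphom (SuspC C) (SuspC D).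
Proof.
apply: (@CompHom (SuspC C) (SuspC D) (suspc_map f)); case=> [|n] //.
rewrite !tie_susp -[RHS]fmap_comp -htrunc_under fmap_comp.
by congr (_ \oc _).
Defined.

Definition SuspC_minus (C : computad) : Cells (SuspC C) 0 := @nvar 0 stage0 susp_pt false.
Definition SuspC_plus (C : computad) : Cells (SuspC C) 0 := @nvar 0 stage0 susp_pt true.

Definition bSuspC (C : computad) : bcomputad :=
  @BComputad (SuspC C) (SuspC_minus C) (SuspC_plus C).

Definition bSuspC_map (C D : computad) (f : comphom C D) : bcomphom (bSuspC C) (bSuspC D) :=
  @BCompHom (bSuspC C) (bSuspC D) (SuspC_map f) (nact_id _) (nact_id _).

Definition SUSPC : functor COMP BCOMP.
Proof.
apply: (@Functor COMP BCOMP bSuspC); apply: (@Functoriality COMP BCOMP _ bSuspC_map).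
- move=> C; apply: bcomphom_ext; apply: comphom_ext; case=> [|n] //.
  exact: (fmap_id (So (susp n)) (trunc C n)).
- move=> C D E g f; apply: bcomphom_ext; apply: comphom_ext; case=> [|n] //.
  exact: (fmap_comp (So (susp n)) (g n) (f n)).
Defined.

Definition suspcell (C : computad) (n : nat) : gsusp (Cell C) n -> Cells (SuspC C) n :=
  match n return gsusp (Cell C) n -> Cells (SuspC C) n with
  | 0 => fun b => @nvar 0 stage0 susp_pt b
  | n'.+1 => fun c => @ncell_susp n' (tower n') (tower n'.+1) (susp n') (trunc C n'.+1) c
  end.

Lemma cbdry_susp (C : computad) n (c : Cells C n) :
  cbdry (@suspcell C n.+1 c) = Ssph (susp n) (cbdry c).
Proof.
by rewrite /cbdry tie_susp Ssph_natural; congr (fmap (Sph (tower n.+1)) _ _);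
  rewrite nbdry_susp.
Qed.

Definition SuspCell (C : computad) : bglobhom (gsusp (Cell C)) (bCell (bSuspC C)).
Proof.
apply: (@BGlobHom (gsusp (Cell C)) (bCell (bSuspC C))
  (@GlobHom (gsusp (Cell C)) (Cell (SuspC C)) (@suspcell C) _ _)) => // -[|n] x.
- by rewrite [LHS](congr1 _ (cbdry_susp x)).
- by rewrite [LHS](congr1 _ (cbdry_susp x)).
- by rewrite [LHS](congr1 _ (cbdry_susp x)).
- by rewrite [LHS](congr1 _ (cbdry_susp x)).
Defined.

Lemma SuspCell_natural (C D : computad) (f : comphom C D) :
  globhom_comp (SuspCell D) (gsusp_map (Cell_map f)) =
  globhom_comp (Cell_map (SuspC_map f)) (SuspCell C).
Proof.
apply: globhom_ext => -[|n] x; first by apply: esym; apply: nact_id.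
exact: ncell_susp_act.
Qed.

Definition free_susp_trunc (X : glob) (k : nat) :
    hom (suspc_trunc (FreeC X) k) (Free (tower k) (gsusp X)) :=
  match k with 0 => tt | n.+1 => idto (SFree (susp n) X) end.

(* In each dimension, the isomorphism underlying the equality [SFree]. *)
Definition free_susp (X : glob) : comphom (SuspC (FreeC X)) (FreeC (gsusp X)).
Proof.
apply: (@CompHom (SuspC (FreeC X)) (FreeC (gsusp X)) (free_susp_trunc X)) => -[|n] //.
rewrite tie_susp [tie _ _]idto_id [LHS]comp1f [tie _ _]idto_id fmap_id [RHS]compf1.
exact: nfree_iso_under.
Defined.

Definition suspvar (X : glob) n (x : gsusp X n) : Cells (SuspC (FreeC X)) n :=
  suspcell (gsusp_map (geta X) n x).

Lemma free_susp_var (X : glob) n (x : gsusp X n) :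
  cact (free_susp X) (suspvar x) = geta (gsusp X) n x.
Proof.
case: n x => [|n] x; first exact: nact_id.
rewrite /suspvar /cact /= ncell_susp_var nact_var.
exact: (@nfree_iso_gen _ _ _ (susp n) X x).
Qed.

Lemma SuspC_map_var (X : glob) (C : computad) (f : comphom (FreeC X) C) n (x : gsusp X n) :
  cact (SuspC_map f) (suspvar x) =
  suspcell (gsusp_map (globhom_comp (Cell_map f) (geta X)) n x).
Proof.
case: n x => [|n] x; first exact: nact_id.
by rewrite /suspvar /cact /= ncell_susp_var nact_var [in RHS]/cact nact_var.
Qed.

Lemma suspvar_ext (X : glob) (C : computad) (f g : comphom (SuspC (FreeC X)) C) :
  (forall n (x : gsusp X n), cact f (suspvar x) = cact g (suspvar x)) -> f = g.
Proof.
move=> fg; apply: comphom_gen_ext => -[|n] v.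
  by have := fg 0 v; rewrite /cact /suspvar !nact_var.
have := fg n.+1 v; rewrite /cact /suspvar /= ncell_susp_var !nact_var.
exact.
Qed.

Lemma cact_comp (C D E : computad) (g : comphom D E) (f : comphom C D) n (c : Cells C n) :
  cact (comphom_comp g f) c = cact g (cact f c).
Proof. exact: nact_comp. Qed.

Lemma cact_Free_var (X Y : glob) (f : globhom X Y) n (x : X n) :
  cact (FreeC_map f) (geta X n x) = geta Y n (f n x).
Proof. exact: nact_var. Qed.

Lemma ceps_var (C : computad) n (c : Cells C n) : cact (ceps C) (geta (Cell C) n c) = c.
Proof. exact: nact_var. Qed.

Lemma free_susp_natural (X Y : glob) (f : globhom X Y) :
  comphom_comp (free_susp Y) (SuspC_map (FreeC_map f)) =
  comphom_comp (FreeC_map (gsusp_map f)) (free_susp X).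
Proof.
apply: suspvar_ext => n x.
rewrite !cact_comp SuspC_map_var !free_susp_var cact_Free_var -free_susp_var.
congr cact; rewrite /suspvar; congr suspcell.
case: n x => [|n] x //.
exact: nact_var.
Qed.

Definition SuspT (X : glob) : bglobhom (gsusp (T X)) (bT (gsusp X)).
Proof.
apply: (bglobhom_comp _ (SuspCell (FreeC X))).
apply: (@BGlobHom (bCell (bSuspC (FreeC X))) (bT (gsusp X)) (Cell_map (free_susp X))).
- exact: (@free_susp_var X 0 false).
- exact: (@free_susp_var X 0 true).
Defined.

Definition LoopT (X : bglob) : globhom (T (gloop X)) (gloop (bT X)) :=
  globhom_comp (gloop_map (fmap bT (gkappa X : hom (gsusp (gloop X) : BGLOB) X)))
    (globhom_comp (gloop_map (SuspT (gloop X))) (gloop_unit (T (gloop X)))).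

Definition loopT_comp (X : bglob) : comphom (SuspC (FreeC (gloop X))) (FreeC X) :=
  comphom_comp (FreeC_map (gkappa X)) (free_susp (gloop X)).

Lemma LoopTE (X : bglob) n (c : T (gloop X) n) :
  sval (LoopT X n c) = cact (loopT_comp X) (@suspcell (FreeC (gloop X)) n.+1 c).
Proof. by rewrite cact_comp. Qed.

Lemma gkappa_natural (X Y : bglob) (f : bglobhom X Y) :
  globhom_comp (gkappa Y) (gsusp_map (gloop_map f)) = globhom_comp f (gkappa X).
Proof.
apply: globhom_ext => -[|n] //= [].
- by rewrite bglobhom_plus.
- by rewrite bglobhom_minus.
Qed.

Lemma loopT_comp_natural (X Y : bglob) (f : bglobhom X Y) :
  comphom_comp (loopT_comp Y) (SuspC_map (FreeC_map (gloop_map f))) =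
  comphom_comp (FreeC_map f) (loopT_comp X).
Proof.
apply: suspvar_ext => n x.
have /(congr1 (fun h => cact h (suspvar x))) := free_susp_natural (gloop_map f).
rewrite !cact_comp => ->; rewrite free_susp_var !cact_Free_var; congr (geta Y n _).
exact: (congr1 (fun h : globhom _ _ => h n x) (gkappa_natural f)).
Qed.

Lemma loopT_comp_mult (X : bglob) :
  comphom_comp (loopT_comp X) (SuspC_map (ceps (FreeC (gloop X)))) =
  comphom_comp (comphom_comp (ceps (FreeC X)) (loopT_comp (bT X)))
    (SuspC_map (FreeC_map (LoopT X))).
Proof.
apply: suspvar_ext => n x.
rewrite !cact_comp !SuspC_map_var.
have h : suspcell (gsusp_map (globhom_comp (Cell_map (FreeC_map (LoopT X)))
    (geta (T (gloop X)))) n x) = suspvar (gsusp_map (LoopT X) n x).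
  case: n x => [|n] x //; rewrite /suspvar /=; congr ncell_susp.
  exact: cact_Free_var.
rewrite h free_susp_var cact_Free_var ceps_var => {h}.
case: n x => [|n] x /=.
  by rewrite free_susp_var cact_Free_var; case: x.
by rewrite [cact (ceps _) _]ceps_var.
Qed.

Lemma ostr_geta (X : omegacat) n (x : X n) : ostr X n (geta X n x) = x.
Proof. exact: (congr1 (fun f : globhom X X => f n x) (ostr_unit X)). Qed.

Lemma ostr_gmu (X : omegacat) n (c : T (T X) n) :
  ostr X n (Tmap (ostr X) n c) = ostr X n (gmu X n c).
Proof. exact: (congr1 (fun f : globhom (T (T X)) X => f n c) (ostr_mult X)). Qed.

Lemma ohom_strE (X Y : omegacat) (f : omegahom X Y) n (c : T X n) :
  f n (ostr X n c) = ostr Y n (Tmap f n c).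
Proof. exact: (congr1 (fun h : globhom (T X) Y => h n c) (ohom_str f)). Qed.

Definition bounder (X : bomegacat) : bglob := @BGlob X (bominus X) (boplus X).

Definition bounder_map (X Y : bomegacat) (f : bomegahom X Y) :
    bglobhom (bounder X) (bounder Y) :=
  @BGlobHom (bounder X) (bounder Y) f (bohom_minus f) (bohom_plus f).

Definition bostr (X : bomegacat) : bglobhom (bT (bounder X)) (bounder X) :=
  @BGlobHom (bT (bounder X)) (bounder X) (ostr X) (ostr_geta _) (ostr_geta _).

Definition homcat_str (X : bomegacat) :
    globhom (T (gloop (bounder X))) (gloop (bounder X)) :=
  globhom_comp (gloop_map (bostr X)) (LoopT (bounder X)).

Lemma homcat_strE (X : bomegacat) n (c : T (gloop (bounder X)) n) :
  sval (homcat_str X n c) =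
  ostr X n.+1 (cact (loopT_comp (bounder X)) (@suspcell (FreeC (gloop (bounder X))) n.+1 c)).
Proof. by rewrite -LoopTE. Qed.

Lemma SuspC_cact (C D : computad) (f : comphom C D) n (c : Cells C n) :
  @suspcell D n.+1 (cact f c) = cact (SuspC_map f) (@suspcell C n.+1 c).
Proof. exact: ncell_susp_act. Qed.

Lemma loopT_comp_naturalE (X Y : bglob) (f : bglobhom X Y) n
  (c : Cells (FreeC (gloop X)) n) :
  cact (loopT_comp Y)
    (@suspcell (FreeC (gloop Y)) n.+1 (cact (FreeC_map (gloop_map f)) c)) =
  cact (FreeC_map f) (cact (loopT_comp X) (@suspcell (FreeC (gloop X)) n.+1 c)).
Proof. by rewrite SuspC_cact -!cact_comp loopT_comp_natural. Qed.

Lemma homcat_unit (X : bomegacat) :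
  globhom_comp (homcat_str X) (geta (gloop (bounder X))) =
  globhom_id (gloop (bounder X)).
Proof.
apply: globhom_ext => n x; apply: gloop_cell_eq.
rewrite [LHS]homcat_strE cact_comp.
rewrite [cact (free_susp _) _](@free_susp_var (gloop (bounder X)) n.+1 x).
by rewrite cact_Free_var ostr_geta.
Qed.

Lemma homcat_mult (X : bomegacat) :
  globhom_comp (homcat_str X) (Tmap (homcat_str X)) =
  globhom_comp (homcat_str X) (gmu (gloop (bounder X))).
Proof.
apply: globhom_ext => n c; apply: gloop_cell_eq.
rewrite [LHS]homcat_strE [RHS]homcat_strE Tmap_comp.
rewrite [X in cact _ (suspcell X)]/(cact (FreeC_map (gloop_map (bostr X)))
  (cact (FreeC_map (LoopT (bounder X))) c)).
rewrite loopT_comp_naturalE [LHS]ostr_gmu; congr (ostr X n.+1 _).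
have /(congr1 (fun h => cact h (@suspcell (FreeC (T (gloop (bounder X)))) n.+1 c))) :=
  loopT_comp_mult (bounder X).
by rewrite !cact_comp -!SuspC_cact => ->.
Qed.

Definition homcat (X : bomegacat) : omegacat := OmegaCat (homcat_unit X) (homcat_mult X).

Lemma homcat_map_proof (X Y : bomegacat) (f : bomegahom X Y) :
  globhom_comp (gloop_map (bounder_map f)) (homcat_str X) =
  globhom_comp (homcat_str Y) (Tmap (gloop_map (bounder_map f))).
Proof.
apply: globhom_ext => n c; apply: gloop_cell_eq.
rewrite [RHS]homcat_strE loopT_comp_naturalE.
rewrite [LHS](congr1 (f n.+1) (homcat_strE c)).
exact: ohom_strE.
Qed.

Definition homcat_map (X Y : bomegacat) (f : bomegahom X Y) :
  omegahom (homcat X) (homcat Y) := @OmegaHom (homcat X) (homcat Y) _ (homcat_map_proof f).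

Definition HOMCAT : functor BOMEGACAT OMEGACAT.
Proof.
apply: (@Functor BOMEGACAT OMEGACAT homcat);
  apply: (@Functoriality BOMEGACAT OMEGACAT _ homcat_map).
- by move=> X; apply: omegahom_ext; apply: globhom_ext => n x; apply: gloop_cell_eq.
- by move=> X Y Z g f; apply: omegahom_ext; apply: globhom_ext => n x;
    apply: gloop_cell_eq.
Defined.

Definition gparallel (X : glob) (k : nat) : X k -> X k -> Prop :=
  match k return X k -> X k -> Prop with
  | 0 => fun _ _ => True
  | k'.+1 => fun x y => src x = src y /\ tgt x = tgt y
  end.

(* [Par X k] is the set of the pairs of parallel (k-1)-cells. *)
Definition Par (X : glob) (k : nat) : Type :=
  match k with 0 => unit | k'.+1 => {p : X k' * X k' | gparallel p.1 p.2} end.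

Lemma Par_eq (X : glob) k (p q : Par X k.+1) : sval p = sval q -> p = q.
Proof.
case: p q => [p hp] [q hq] /= e; case: q / e hq => hq.
by rewrite (proof_irrelevance _ hp hq).
Qed.

Lemma gpar_proof (X : glob) k (x : X k.+1) : gparallel (src x) (tgt x).
Proof. by case: k x => [|k] x //=; rewrite src_glob tgt_glob. Qed.

Definition gpar (X : glob) (k : nat) : X k -> Par X k :=
  match k return X k -> Par X k with
  | 0 => fun=> tt
  | k'.+1 => fun x =>
      exist (fun p : X k' * X k' => gparallel p.1 p.2) (src x, tgt x) (gpar_proof x)
  end.

Lemma gpar_parallel (X : glob) k (x y : X k) : gpar x = gpar y -> gparallel x y.
Proof. by case: k x y => [|k] x y //= [-> ->]. Qed.

Lemma gparallel_gbdry (X : glob) k (x y : X k) :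
  gparallel x y -> gbdry (tower k) x = gbdry (tower k) y.
Proof.
case: k x y => [|k] x y //= [es et].
by apply: nsph_ext; apply: ncell_eq; rewrite /= ?es ?et.
Qed.

Lemma csphere_proof (C : computad) (X : glob) (f : globhom (Cell C) X) k
  (A : @nsph k (tower k) (trunc C k.+1)) : gparallel (f k (pr1 A)) (f k (pr2 A)).
Proof.
case: k A => [|k] A //=; rewrite !gmap_src !gmap_tgt /= /csrc /ctgt.
by rewrite /cbdry (parallel A).
Qed.

(* The action of a map out of [Cell C] on spheres. *)
Definition csphere (C : computad) (X : glob) (f : globhom (Cell C) X) (k : nat) :
    Sph (tower k) (trunc C k) -> Par X k :=
  match k return Sph (tower k) (trunc C k) -> Par X k with
  | 0 => fun=> tt
  | n.+1 => fun A : @nsph n (tower n) (trunc C n.+1) =>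
      exist (fun p : X n * X n => gparallel p.1 p.2) (f n (pr1 A), f n (pr2 A))
        (csphere_proof f A)
  end.

Lemma gpar_csphere (C : computad) (X : glob) (f : globhom (Cell C) X) k (c : Cells C k) :
  gpar (f k c) = csphere f (cbdry c).
Proof. by case: k c => [|k] c //; apply: Par_eq; rewrite /= gmap_src gmap_tgt. Qed.

Lemma gpar_csphere_free (Y X : glob) (f : globhom (T Y) X) k
  (c : @ncell k (tower k) (nfree (tower k) Y)) :
  gpar (f k c) = @csphere (FreeC Y) X f k (nbdry c).
Proof.
rewrite (@gpar_csphere (FreeC Y) X f k c) /cbdry /tie.
by rewrite idto_id (@fmap_id_app _ (Sph (tower k))).
Qed.

Definition par_sph (X : glob) (k : nat) : Par X k -> Sph (tower k) (Free (tower k) X) :=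
  match k return Par X k -> Sph (tower k) (Free (tower k) X) with
  | 0 => fun=> tt
  | n.+1 => fun p =>
      @NSph n (tower n) (nfree (tower n) X)
        (@nvar n (tower n) (nfree (tower n) X) (sval p).1)
        (@nvar n (tower n) (nfree (tower n) X) (sval p).2)
        (gparallel_gbdry (svalP p))
  end.

Lemma par_sph_gpar (X : glob) k (x : X k) : par_sph (gpar x) = gbdry (tower k) x.
Proof. by case: k x => [|k] x //; apply: nsph_ext. Qed.

(* [interp r C] is the set of the data that determine a morphism of
   omega-categories from the free one on the (k-1)-computad [C] to [X]: an
   assignment of cells of [X] to the generators of [C] that is compatible with
   boundaries.  The value of the morphism on [coh(B, A, t)] is then the structure
   map of [X] applied to [coh(B, A, icomp r rho t)], where [icomp r rho t] is the
   composite of [t] and the morphism, as a map of globular sets from [Pos B] to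
   [X] under [Free].  [isph] is the action of the morphism on spheres, and [ican]
   is the morphism given by the structure map of [X]. *)
Record istage (X : omegacat) (k : nat) := IStage {
  interp : Comp (tower k) -> Type;
  isph : forall C, interp C -> Sph (tower k) C -> Par X k;
  icomp : forall C, interp C -> forall Y : glob,
    hom (Free (tower k) Y) C -> hom (Free (tower k) Y) (Free (tower k) X);
  icomp_gbdry : forall C (rho : interp C) (Y : glob) (t : hom (Free (tower k) Y) C)
    (y : Y k), fmap (Sph (tower k)) (icomp rho t) (gbdry (tower k) y) =
    par_sph (isph rho (fmap (Sph (tower k)) t (gbdry (tower k) y)));
  ican : interp (Free (tower k) X);
  icomp_can : forall C (rho : interp C) (Y Z : glob) (t : hom (Free (tower k) Y) C)
    (u : hom (Free (tower k) Z) (Free (tower k) Y)),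
    icomp rho (t \oc u) = icomp ican (icomp rho t \oc u);
  isph_can : forall C (rho : interp C) (Y : glob) (t : hom (Free (tower k) Y) C)
    (A : Sph (tower k) (Free (tower k) Y)),
    isph rho (fmap (Sph (tower k)) t A) = isph ican (fmap (Sph (tower k)) (icomp rho t) A);
  ican_sph : forall A : Sph (tower k) (Free (tower k) X),
    isph ican A = @csphere (FreeC X) X (ostr X) k A;
  ican_transpose : forall (Y : glob) (t : hom (Free (tower k) Y) (Free (tower k) X)),
    exists t' : hom (Free (tower k) Y) (Free (tower k) (T X)),
    [/\ forall y : Y k, fmap (Sph (tower k)) t' (gbdry (tower k) y) =
          par_sph (@csphere (FreeC X) (T X) (globhom_id (T X)) k
            (fmap (Sph (tower k)) t (gbdry (tower k) y))),
        ceps (FreeC X) k \oc t' = t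
      & @fmap GLOB _ (Free (tower k)) (T X) X (ostr X) \oc t' = icomp ican t] }.

Arguments interp {X k} r C : rename.
Arguments isph {X k} r {C} rho A : rename.
Arguments icomp {X k} r {C} rho {Y} t : rename.
Arguments ican {X k} r : rename.

Section NextInterp.
Variables (X : omegacat) (n : nat) (r : istage X n).
Local Notation S := (tower n).

Record ninterp (C : ncomp S) := NInterp {
  iunder : interp r (under C);
  igen : gen C -> X n;
  igen_bound : forall v, gpar (igen v) = isph r iunder (bound v) }.

Section Eval.
Variables (C : ncomp S) (rho : ninterp C).

Lemma icoh_proof (B : tree) (t : hom (Free S (Pos B)) (under C))
  (x : forall p : Pos B n,
    {x : X n | gpar x = isph r (iunder rho) (fmap (Sph S) t (gbdry S p))}) p :
  @nbdry n S (nfree S X) (nvar (sval (x p) : gen (nfree S X))) =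
  fmap (Sph S) (icomp r (iunder rho) t) (gbdry S p).
Proof. by rewrite icomp_gbdry; case: (x p) => y /= <-; rewrite par_sph_gpar. Qed.

Definition icoh_hom (B : tree) (t : hom (Free S (Pos B)) (under C))
    (x : forall p : Pos B n,
      {x : X n | gpar x = isph r (iunder rho) (fmap (Sph S) t (gbdry S p))}) :
    nhom (nfree S (Pos B)) (nfree S X) :=
  @NHom n S (nfree S (Pos B)) (nfree S X) (icomp r (iunder rho) t)
    (fun p => @nvar n S (nfree S X) (sval (x p))) (icoh_proof x).

Definition icoh (B : tree) (dimB : dim B <= n) (A : Sph S (Free S (Pos B)))
    (fullA : full S B A) (t : hom (Free S (Pos B)) (under C))
    (x : forall p : Pos B n,
      {x : X n | gpar x = isph r (iunder rho) (fmap (Sph S) t (gbdry S p))}) : X n :=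
  ostr X n (ncoh dimB fullA (icoh_hom x)).

Lemma gpar_icoh B dimB A fullA t x :
  gpar (@icoh B dimB A fullA t x) = isph r (iunder rho) (fmap (Sph S) t A).
Proof. by rewrite gpar_csphere_free isph_can ican_sph. Qed.

Fixpoint ieval (c : precell C) :
    wf c -> {x : X n | gpar x = isph r (iunder rho) (prebdry c)} :=
  match c return wf c -> {x : X n | gpar x = isph r (iunder rho) (prebdry c)} with
  | prevar v => fun=>
      exist (fun x => gpar x = isph r (iunder rho) (bound v)) (igen rho v)
        (igen_bound rho v)
  | precoh B dimB A fullA t tV => fun w =>
      let x p : {x : X n | gpar x = isph r (iunder rho) (fmap (Sph S) t (gbdry S p))} :=
        exist _ (sval (ieval (proj1 (w p))))
          (etrans (svalP (ieval (proj1 (w p)))) (congr1 (isph r (iunder rho)) (proj2 (w p))))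
      in exist (fun x => gpar x = isph r (iunder rho) (fmap (Sph S) t A))
           (@icoh B dimB A fullA t x) (gpar_icoh dimB fullA x)
  end.

Definition nieval (c : ncell C) : X n := sval (ieval (svalP c)).

Lemma gpar_nieval (c : ncell C) : gpar (nieval c) = isph r (iunder rho) (nbdry c).
Proof. exact: (svalP (ieval (svalP c))). Qed.

Lemma nieval_var (v : gen C) : nieval (nvar v) = igen rho v.
Proof. by []. Qed.

Lemma nicomp_proof (Y : glob) (t : nhom (nfree S Y) C) (y : Y n) :
  @nbdry n S (nfree S X) (nvar (nieval (hgen t y) : gen (nfree S X))) =
  fmap (Sph S) (icomp r (iunder rho) (hunder t)) (gbdry S y).
Proof.
have e : fmap (Sph S) (hunder t) (gbdry S y) = nbdry (hgen t y) := esym (hbound t y).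
by rewrite icomp_gbdry e -gpar_nieval par_sph_gpar.
Qed.

Definition nicomp (Y : glob) (t : nhom (nfree S Y) C) : nhom (nfree S Y) (nfree S X) :=
  @NHom n S (nfree S Y) (nfree S X) (icomp r (iunder rho) (hunder t))
    (fun y => @nvar n S (nfree S X) (nieval (hgen t y))) (nicomp_proof t).

Lemma nieval_coh (B : tree) (dimB : dim B <= n) (A : Sph S (Free S (Pos B)))
  (fullA : full S B A) (t : nhom (nfree S (Pos B)) C) :
  nieval (ncoh dimB fullA t) = ostr X n (ncoh dimB fullA (nicomp t)).
Proof.
rewrite /nieval /= /icoh; congr (ostr X n (ncoh _ _ _)).
apply: nhom_ext => [|p] //=; congr nvar; rewrite /nieval.
by congr (sval (ieval _)); apply: proof_irrelevance.
Qed.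

Lemma nisph_proof (A : nsph C) : gparallel (nieval (pr1 A)) (nieval (pr2 A)).
Proof. by apply: gpar_parallel; rewrite !gpar_nieval parallel. Qed.

Definition nisph (A : nsph C) : Par X n.+1 :=
  exist (fun p : X n * X n => gparallel p.1 p.2) (nieval (pr1 A), nieval (pr2 A))
    (nisph_proof A).

Lemma nicomp_gbdry (Y : glob) (t : nhom (nfree S Y) C) (y : Y n.+1) :
  nsph_act (nicomp t) (ngbdry S y) = @par_sph X n.+1 (nisph (nsph_act t (ngbdry S y))).
Proof. by apply: nsph_ext; rewrite /= nact_var /= nact_var. Qed.

End Eval.

Lemma nican_proof (x : X n) : gpar x = isph r (ican r) (@gbdry n S X x).
Proof.
rewrite ican_sph; have := @gpar_csphere_free X X (ostr X) n (@nvar n S (nfree S X) x).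
by rewrite [ostr X n _](ostr_geta (x : X n)) => ->.
Qed.

Definition nican : ninterp (nfree S X) := @NInterp (nfree S X) (ican r) id nican_proof.

Lemma nicomp_can_eval (C : ncomp S) (rho : ninterp C) (Y : glob)
  (t : nhom (nfree S Y) C) (c : ncell (nfree S Y)) :
  nieval rho (nact t c) = nieval nican (nact (nicomp rho t) c).
Proof.
elim/ncell_ind_coh: c => [y|B dB A fA u IH]; first by rewrite !nact_var.
rewrite !nact_coh !nieval_coh; congr (ostr X n _); congr ncoh.
apply: nhom_ext => [|p] /=; first exact: icomp_can.
by rewrite IH.
Qed.

Lemma nicomp_can (C : ncomp S) (rho : ninterp C) (Y Z : glob)
  (t : nhom (nfree S Y) C) (u : nhom (nfree S Z) (nfree S Y)) :
  nicomp rho (nhom_comp t u) = nicomp nican (nhom_comp (nicomp rho t) u).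
Proof.
apply: nhom_ext => [|z] /=; first exact: icomp_can.
by rewrite nicomp_can_eval.
Qed.

Lemma nisph_can (C : ncomp S) (rho : ninterp C) (Y : glob)
  (t : nhom (nfree S Y) C) (A : nsph (nfree S Y)) :
  nisph rho (nsph_act t A) = nisph nican (nsph_act (nicomp rho t) A).
Proof. by apply: Par_eq; congr pair; apply: nicomp_can_eval. Qed.

Lemma ntranspose (Y : glob) (t : nhom (nfree S Y) (nfree S X)) :
  (forall y, nieval nican (hgen t y) = ostr X n (hgen t y)) ->
  exists t' : nhom (nfree S Y) (nfree S (T X)),
  [/\ forall y, hgen t' y = @nvar n S (nfree S (T X)) (hgen t y),
      nhom_comp (ceps (FreeC X) n.+1) t' = t
    & nhom_comp (nfree_map S (ostr X)) t' = nicomp nican t].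
Proof.
move=> ht; have [t' [t'b et' st']] := ican_transpose r (hunder t).
have b (y : Y n) : @nbdry n S (nfree S (T X)) (nvar (hgen t y : gen (nfree S (T X)))) =
    fmap (Sph S) t' (gbdry S y).
  have e : fmap (Sph S) (hunder t) (gbdry S y) = nbdry (hgen t y) := esym (hbound t y).
  rewrite t'b e -[LHS]/(@gbdry n S (T X) (hgen t y)) -par_sph_gpar; congr par_sph.
  exact: (@gpar_csphere_free X (T X) (globhom_id (T X)) n (hgen t y)).
exists (@NHom n S (nfree S Y) (nfree S (T X)) t'
  (fun y => @nvar n S (nfree S (T X)) (hgen t y)) b); split=> //.
- apply: nhom_ext => [|y] /=; last exact: nact_var.
  rewrite -et'; congr (_ \oc t').
  by rewrite /tie_inv idto_id [LHS]comp1f.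
- apply: nhom_ext => [|y] //=; rewrite nact_var /=.
  by rewrite ht.
Qed.

Lemma nican_eval (c : ncell (nfree S X)) : nieval nican c = ostr X n c.
Proof.
elim/ncell_ind_coh: c => [x|B dB A fA t IH].
  by rewrite nieval_var; apply: esym; apply: (ostr_geta (x : X n)).
have [t' [_ et st]] := ntranspose IH.
rewrite nieval_coh -st -nact_coh.
rewrite [LHS](ostr_gmu (@ncoh n S (nfree S (T X)) B dB A fA t')).
congr (ostr X n _).
rewrite -[in RHS]et -nact_coh.
by [].
Qed.

Lemma nican_sph (A : nsph (nfree S X)) :
  nisph nican A = @csphere (FreeC X) X (ostr X) n.+1 A.
Proof. by apply: Par_eq; congr pair; apply: nican_eval. Qed.

Lemma nican_transpose (Y : glob) (t : nhom (nfree S Y) (nfree S X)) :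
  exists t' : nhom (nfree S Y) (nfree S (T X)),
  [/\ forall y : Y n.+1, nsph_act t' (ngbdry S y) =
        @par_sph (T X) n.+1 (@csphere (FreeC X) (T X) (globhom_id (T X)) n.+1
          (nsph_act t (ngbdry S y))),
      nhom_comp (ceps (FreeC X) n.+1) t' = t
    & nhom_comp (nfree_map S (ostr X)) t' = nicomp nican t].
Proof.
have [t' [gt' et st]] := ntranspose (fun y => nican_eval (hgen t y)).
exists t'; split=> // y.
by apply: nsph_ext; rewrite /= nact_var gt' nact_var.
Qed.

Definition interp_next : istage X n.+1 :=
  @IStage X n.+1 ninterp nisph nicomp nicomp_gbdry nican nicomp_can nisph_can
    nican_sph nican_transpose.

End NextInterp.

Definition interp0 (X : omegacat) : istage X 0.
Proof.
apply: (@IStage X 0 (fun=> unit) (fun _ _ _ => tt) (fun _ _ _ _ => tt) _ tt) => //=.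
by move=> Y [] ; exists tt; split.
Defined.

Fixpoint interps (X : omegacat) (k : nat) : istage X k :=
  match k with 0 => interp0 X | n.+1 => interp_next (interps X n) end.

Definition indecomposable (X : omegacat) (n : nat) (x : X n) : Prop :=
  ~ exists (B : tree) (dimB : dim B <= n) (A : Sph (tower n) (Free (tower n) (Pos B)))
      (fullA : full (tower n) B A) (f : globhom (Pos B) X),
    x = ostr X n (ncoh dimB fullA (nfree_map (tower n) f)).

(* The pullback of the spheres of [C] and the indecomposable cells of [X] over
   the parallel pairs of [X]. *)
Record cxgen (X : omegacat) (n : nat) (C : Comp (tower n)) (rho : interp (interps X n) C) :=
  CxGen {
    cxsph : Sph (tower n) C;
    cxcell : X n;
    cxind : indecomposable cxcell;
    cxpar : gpar cxcell = isph (interps X n) rho cxsph }.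

Record cxdata (X : omegacat) (k : nat) := CxData {
  cxcomp : Comp (tower k);
  cxinterp : interp (interps X k) cxcomp }.

Definition cxnext (X : omegacat) (n : nat) (d : cxdata X n) : cxdata X n.+1 :=
  let C := @NComp n (tower n) (cxcomp d) (cxgen (cxinterp d)) (@cxsph _ _ _ _) in
  @CxData X n.+1 C
    (@NInterp X n (interps X n) C (cxinterp d) (@cxcell _ _ _ _) (@cxpar _ _ _ _)).

Fixpoint cxtower (X : omegacat) (k : nat) : cxdata X k :=
  match k with
  | 0 => @CxData X 0 (tt : Comp (tower 0)) tt
  | n.+1 => cxnext (cxtower X n)
  end.

Definition compOf (X : omegacat) : computad :=
  @Computad (fun k => cxcomp (cxtower X k)) (fun=> erefl).

Definition csigma_cell (X : omegacat) (n : nat) (c : Cells (compOf X) n) : X n :=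
  nieval (cxinterp (cxtower X n.+1)) c.

Lemma csigma_sph (X : omegacat) n (c : Cells (compOf X) n) :
  gpar (csigma_cell c) = isph (interps X n) (cxinterp (cxtower X n)) (cbdry c).
Proof.
rewrite /cbdry /tie idto_id (@fmap_id_app _ (Sph (tower n))).
exact: gpar_nieval.
Qed.

Definition csigma_hom (X : omegacat) : globhom (Cell (compOf X)) X.
Proof.
by apply: (@GlobHom (Cell (compOf X)) X (@csigma_cell X)) => n c;
  have /(congr1 sval) [] := csigma_sph c.
Defined.

Lemma csigma_comp (X : omegacat) k :
  icomp (interps X k) (cxinterp (cxtower X k)) (ceps (compOf X) k) =
  @fmap GLOB _ (Free (tower k)) _ _ (csigma_hom X).
Proof.
elim: k => [|k IH] //; apply: nhom_ext => [|c] //.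
rewrite -[RHS]IH /=; congr icomp.
by rewrite /tie_inv idto_id [LHS]comp1f.
Qed.

Lemma csigma_str (X : omegacat) :
  globhom_comp (csigma_hom X) (Cell_map (ceps (compOf X))) =
  globhom_comp (ostr X) (Tmap (csigma_hom X)).
Proof.
apply: globhom_ext => n c.
rewrite [LHS](@nicomp_can_eval X n (interps X n) _ (cxinterp (cxtower X n.+1))
  (Cell (compOf X)) (ceps (compOf X) n.+1) c) nican_eval.
by congr (ostr X n _); rewrite [nicomp _ _](csigma_comp X n.+1).
Qed.

(* The interpretations that define [compOf X] are the restrictions of a single
   morphism of omega-categories. *)
Definition csigma (X : omegacat) : omegahom (KTob (compOf X)) X :=
  @OmegaHom (KTob (compOf X)) X (csigma_hom X) (csigma_str X).

(* Main.v *)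
Set Warnings "-notation-overridden".
From Stdlib Require Import Wellfounded ProofIrrelevance Classical ClassicalEpsilon.
From mathcomp Require Import all_boot.
Require Import Defs.

Set Implicit Arguments.
Unset Strict Implicit.
Unset Printing Implicit Defensive.

(** Let [C] be a bipointed computad and let [X] be the hom omega-category of the
    omega-category of [C].  The heart of the matter is that [X] is free on the
    computad [compOf X], that is, that [csigma X] is an isomorphism.

    An omega-category is free on the computad of its indecomposable cells as soon as
    a cell is in at most one way the composite [ostr X (coh(B, A, Free f))] of
    other cells and the relation between a composite and its constituents of the
    same dimension is well founded ([csigma_bijective]).  Indeed, dimension by
    dimension, a cell of [X] is then either indecomposable, so that it is the image
    of a generator, or the composite of smaller cells; uniqueness makes the resulting
    cell of [compOf X] unique.

    Both conditions hold for [X].  The cells of [X] are cells of [C], one dimension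
    up, and the structure map sends [coh(B, A, Free f)] to the coherence cell
    [coh(br[B], A', t)] of [C], where [A'] is the suspension of [A] and [t] is
    determined by [f].  Suspension is injective on trees, spheres, cells and
    morphisms ([susp_inj_all]), and [t] sends the position [p] to the cell [f p], so
    the composite determines [B], [A] and [Free f] ([susp_coh_inj]); and the
    constituents of the composite in the same dimension are immediate subterms of it,
    whence well-foundedness ([hom_wf]).

    Finally, the comparison functor [KT] is fully faithful ([KT_faithful],
    [KT_lift_eq]), because morphisms of computads may send generators to arbitrary
    cells.  Therefore the isomorphisms [csigma] transport the functor
    [HOMCAT \o BKT] to a functor that takes values in computads, and they are
    natural by construction.  The second natural isomorphism underlies the first. *)

(** * Maps from free computads *)

Local Notation freemap k f := (@fmap GLOB _ (Free (tower k)) _ _ f).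

Lemma free_epi k (Y Z : glob) (i : globhom Y Z) (D : Comp (tower k))
    (t u : hom (Free (tower k) Z) D) :
  (forall j, j < k -> forall z : Z j, exists y, i j y = z) ->
  t \oc freemap k i = u \oc freemap k i -> t = u.
Proof.
elim: k D t u => [|k IH] D t u isurj e; first by case: t u {e} => -[].
apply: nhom_ext => [|z].
  apply: IH => [j lt_jk|]; first by apply: isurj; apply: ltnW.
  exact: (congr1 (@hunder _ _ _ _) e).
have [y <-] := isurj k (ltnSn k) z.
have := congr1 (fun h : nhom (nfree (tower k) Y) D => hgen h y) e.
by rewrite /= !nact_var.
Qed.

Lemma free_congr k (Y Z : glob) (f g : globhom Y Z) :
  (forall j, j < k -> forall y : Y j, f j y = g j y) -> freemap k f = freemap k g.
Proof.
elim: k => [|k IH] fg //; apply: nhom_ext => [|y].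
  by apply: IH => j lt_jk; apply: fg; apply: ltnW.
by congr nvar; apply: fg.
Qed.

(** The part of [Y] below dimension [k]: it is what a morphism out of
    [Free (tower k) Y] can see. *)
Definition skel_cell (k : nat) (Y : glob) (j : nat) : Type := {y : Y j | j < k}.

Lemma skel_cell_eq k Y j (x y : skel_cell k Y j) : sval x = sval y -> x = y.
Proof.
case: x y => [x px] [y py] /= e; case: y / e.
by rewrite (bool_irrelevance px py).
Qed.

Definition skel (k : nat) (Y : glob) : glob.
Proof.
apply: (@Glob (skel_cell k Y)
  (fun j y => exist _ (src (sval y)) (ltnW (svalP y)))
  (fun j y => exist _ (tgt (sval y)) (ltnW (svalP y)))) => j y; apply: skel_cell_eq.
- exact: src_glob.
- exact: tgt_glob.
Defined.

Definition skel_incl k Y : globhom (skel k Y) Y.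
Proof. by apply: (@GlobHom (skel k Y) Y (fun j y => sval y)). Defined.

(** Telling dimension [k] from the lower ones takes a case analysis on indices and a
    cast along an equality of dimensions; the existential quantifier hides both. *)
Lemma splice (Y Z : nat -> Type) k (g : Y k -> Z k)
    (h : forall j, j < k -> Y j -> Z j) :
  (forall j, k < j -> Y j -> False) ->
  exists f : forall j, Y j -> Z j,
    (forall y, f k y = g y) /\ forall j (lt : j < k) y, f j y = h j lt y.
Proof.
move=> Y0.
have ex j : exists fj : Y j -> Z j,
    (forall e : k = j, fj = ecast j (Y j -> Z j) e g) /\
    (forall lt : j < k, fj = h j lt).
  have [lt|[gt|->]] : j < k \/ (k < j \/ j = k).
  - by case: ltngtP => //; auto.
  - exists (h j lt); split=> [e|lt']; first by exfalso; move: lt; rewrite e ltnn.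
    by rewrite (bool_irrelevance lt lt').
  - exists (fun y => False_rect _ (Y0 j gt y)); split=> [e|lt]; exfalso.
      by move: gt; rewrite e ltnn.
    by move: lt; rewrite ltnNge (ltnW gt).
  - exists g; split=> [e|lt]; first by rewrite (proof_irrelevance _ e erefl).
    by exfalso; move: lt; rewrite ltnn.
pose f j := constructive_indefinite_description _ (ex j).
exists (fun j => sval (f j)); split=> [y|j lt y].
  by rewrite (proj1 (svalP (f k)) erefl).
by rewrite (proj2 (svalP (f j)) lt).
Qed.

Lemma ceps_gbdry (C : computad) k (c : Cells C k) :
  fmap (Sph (tower k)) (ceps C k) (@gbdry k (tower k) (Cell C) c) = cbdry c.
Proof. exact: (svalP (ceps_rec C k)). Qed.

(** The adjunction of [FREE] and [CELL] in a single dimension: since [Y] has no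
    cells that [t] does not see, [t] extends to a map of computads from [FreeC Y]
    to [C], which has a transpose [f].  This turns the substitution of a coherence
    cell, a morphism of truncated computads, into a map of globular sets. *)
Lemma transpose (C : computad) k (Y : glob) (t : hom (Free (tower k) Y) (trunc C k)) :
  (forall j, k <= j -> Y j -> False) ->
  exists f : globhom Y (Cell C), t = ceps C k \oc freemap k f.
Proof.
elim: k Y t => [|k IH] Y t Y0.
  have f : globhom Y (Cell C).
    by apply: (@GlobHom Y (Cell C) (fun j y => False_rect _ (Y0 j isT y))) => j y;
      exfalso; apply: (Y0 _ isT y).
  have unit_eq (u v : unit) : u = v by case: u v => -[].
  by exists f; apply: unit_eq.
(* The induction hypothesis applies to the skeleton, as [Y] may have [k]-cells. *)
pose t0 : hom (Free (tower k) Y) (trunc C k) := tie C k \oc @hunder k (tower k) _ _ t.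
have [|f' ef'] := IH (skel k Y) (t0 \oc freemap k (skel_incl k Y)).
  by move=> j le_kj [y]; rewrite ltnNge le_kj.
have [|f [fk flt]] := @splice Y (Cells C) k (@hgen k (tower k) _ _ t)
  (fun j lt y => f' j (exist (fun=> j < k) y lt)); first exact: Y0.
have bt (y : Y k) : cbdry (f k y) = fmap (Sph (tower k)) t0 (gbdry (tower k) y).
  by rewrite fk /cbdry (hbound t y) -fmap_comp_app.
(* Only the case of a [k]-cell has content: there the lower part and the new
   dimension meet, and compatibility is the boundary condition of [t]. *)
have key j (y : Y j.+1) : src (f _ y : Cell C j.+1) = f j (src y) /\
   tgt (f _ y : Cell C j.+1) = f j (tgt y).
  have [lt|[gt|e]] : j.+1 < k \/ (k < j.+1 \/ j.+1 = k).
  - by case: ltngtP => //; auto.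
  - rewrite !(flt _ lt) !(flt _ (ltnW lt)) gmap_src gmap_tgt.
    by split; congr (f' j _); apply: skel_cell_eq.
  - by case: (Y0 j.+1 gt y).
  - case: k / e t t0 f' ef' fk flt bt Y0 {IH} => t t0 f' ef' fk flt bt Y0.
    have hs (x : Y j) (lt : j < j.+1) :
        @hgen j (tower j) (nfree (tower j) Y) _ t0 x = f j x.
      rewrite (flt j lt x).
      have := congr1 (fun h : nhom (nfree (tower j) (skel j.+1 Y)) (trunc C j.+1) =>
        hgen h (exist (fun=> j < j.+1) x lt)) ef'.
      by rewrite /= !nact_var.
    rewrite -!(hs _ (ltnSn j)) /= /csrc /ctgt bt /=.
    by rewrite !nact_var.
pose F : globhom Y (Cell C) :=
  @GlobHom Y (Cell C) f (fun j y => proj1 (key j y)) (fun j y => proj2 (key j y)).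
exists F; apply: nhom_ext => [|y]; last by rewrite /= nact_var /= fk.
change (@hunder k (tower k) _ _ t = (tie_inv C k \oc ceps C k) \oc freemap k F).
have -> : @hunder k (tower k) _ _ t = tie_inv C k \oc t0.
  by rewrite /t0 compA tieK comp1f.
rewrite -compA; congr (_ \oc _).
apply: (@free_epi k (skel k Y) Y (skel_incl k Y)) => [j lt z|].
  by exists (exist _ z lt).
rewrite ef' -compA; congr (_ \oc _).
rewrite -[RHS](@fmap_comp GLOB _ (Free (tower k))).
apply: free_congr => j lt [y lt'] /=.
by rewrite (flt j lt y) (bool_irrelevance lt' lt).
Qed.

Lemma pos_transpose (C : computad) n (B : tree)
    (t : nhom (nfree (tower n) (Pos B)) (trunc C n.+1)) :
  dim B <= n ->
  exists f : globhom (Pos B) (Cell C), t = ceps C n.+1 \oc freemap n.+1 f.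
Proof.
move=> dB; apply: (@transpose C n.+1) => j lt_nj.
by apply: Pos_dim; apply: leq_trans lt_nj.
Qed.

(** * The comparison functor is fully faithful *)

Lemma KT_faithful (A B : computad) (f g : comphom A B) : KTmap f = KTmap g -> f = g.
Proof.
move=> e; apply: comphom_gen_ext => n v.
have := congr1 (fun h : omegahom (KTob A) (KTob B) => h n (@nvar n (tower n) _ v)) e.
by rewrite /= /cact !nact_var.
Qed.

Section Full.
Variables (A B : computad) (h : omegahom (KTob A) (KTob B)).

(** The recursive construction of the morphism of computads needs an invariant that
    ensures both that the boundaries of the next generators match and that the next
    component acts on all cells as [h].  Naturality of the counit is such an
    invariant. *)
Definition extends k (f : hom (trunc A k) (trunc B k)) : Prop :=
  f \oc ceps A k = ceps B k \oc freemap k (h : globhom (Cell A) (Cell B)).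

Lemma extends_cbdry k f (c : Cells A k) : @extends k f ->
  cbdry (h k c : Cells B k) = fmap (Sph (tower k)) f (cbdry c).
Proof.
move=> ef; rewrite -[in RHS](ceps_gbdry c) -[RHS]fmap_comp_app ef.
by rewrite fmap_comp_app gbdry_natural ceps_gbdry.
Qed.

Lemma lift_bound k f (ef : @extends k f) (v : @gen k (tower k) (trunc A k.+1)) :
  @nbdry k (tower k) (trunc B k.+1) (h k (@nvar k (tower k) _ v)) =
  fmap (Sph (tower k)) (tie_inv B k \oc (f \oc tie A k)) (bound v).
Proof.
rewrite !fmap_comp_app.
have -> : fmap (Sph (tower k)) (tie A k) (bound v) = @cbdry A k (@nvar k (tower k) _ v) by [].
by rewrite -(extends_cbdry _ ef) /cbdry -[RHS]fmap_comp_app tieK fmap_id.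
Qed.

Definition lift_next k f (ef : @extends k f) : hom (trunc A k.+1) (trunc B k.+1) :=
  @NHom k (tower k) (trunc A k.+1) (trunc B k.+1) (tie_inv B k \oc (f \oc tie A k))
    (fun v => h k (@nvar k (tower k) _ v)) (lift_bound ef).

(** A coherence cell is the value of the structure map on a coherence cell of
    [Cell A], by [pos_transpose], and [h] commutes with the structure maps. *)
Lemma lift_next_cell k f (ef : @extends k f) (c : Cells A k) :
  @nact k (tower k) _ _ (lift_next ef) c = h k c.
Proof.
elim/ncell_ind_coh: c => [v|D dD S fS t IH]; first exact: nact_var.
have [u eu] := pos_transpose t dD.
have -> : ncoh dD fS t = cact (ceps A) (ncoh dD fS (nfree_map (tower k) u)).
  by rewrite /cact nact_coh [in LHS]eu.
rewrite [RHS](ohom_strE h) [LHS](esym (nact_comp _ _ _)) /=.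
rewrite /cact !nact_coh; congr ncoh.
apply: nhom_ext => [|p] /=.
  rewrite -!compA; congr (_ \oc _).
  rewrite [tie A k \oc _]compA tie_invK comp1f.
  by rewrite compA [in LHS]ef -compA.
rewrite [LHS]nact_var nact_var [RHS]nact_var /=.
by have := IH p; rewrite eu /= nact_var.
Qed.

Lemma lift_next_extends k f (ef : @extends k f) : @extends k.+1 (lift_next ef).
Proof.
apply: nhom_ext => [|c].
  change ((tie_inv B k \oc (f \oc tie A k)) \oc (tie_inv A k \oc ceps A k) =
    (tie_inv B k \oc ceps B k) \oc freemap k (h : globhom (Cell A) (Cell B))).
  rewrite -!compA; congr (_ \oc _).
  by rewrite [tie A k \oc _]compA tie_invK comp1f ef.
by rewrite /= [RHS]nact_var [LHS](lift_next_cell ef).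
Qed.

Fixpoint lift_rec k : {f : hom (trunc A k) (trunc B k) | extends f} :=
  match k with
  | 0 => exist (@extends 0) tt erefl
  | k'.+1 => exist (@extends k'.+1) (lift_next (svalP (lift_rec k')))
      (lift_next_extends (svalP (lift_rec k')))
  end.

Definition KT_lift : comphom A B.
Proof.
apply: (@CompHom A B (fun k => sval (lift_rec k))) => k.
by rewrite /thunder /= compA tie_invK comp1f.
Defined.

Lemma KT_lift_eq : KTmap KT_lift = h.
Proof.
apply: omegahom_ext; apply: globhom_ext => n c.
exact: (lift_next_cell (svalP (lift_rec n)) c).
Qed.

End Full.

(** * Omega-categories that are free on their indecomposable cells *)

Lemma par_sph_inj (X : glob) k : injective (@par_sph X k).
Proof.
case: k => [|k] p q; first by case: p q => -[].
move=> e; apply: Par_eq; case: p q e => [[a b] /= p] [[a' b'] /= q] e.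
have /= [eb] := congr1 (fun A => sval (pr2 A)) e.
have /= [ea] := congr1 (fun A => sval (pr1 A)) e.
by rewrite /= ea eb.
Qed.

Lemma gparallel_gpar (X : glob) k (x y : X k) : gparallel x y -> gpar x = gpar y.
Proof. by case: k x y => [|k] x y // [es et]; apply: Par_eq; rewrite /= es et. Qed.

(** The dependency on the tree is expressed by casts along a single equality, so that
    one case analysis substitutes in all the components. *)
Lemma precoh_tree_inj n (S : stage n) (C : ncomp S) B B' dB dB' A A' fA fA' t t' tV tV' :
  @precoh n S C B dB A fA t tV = @precoh n S C B' dB' A' fA' t' tV' ->
  exists e : B = B',
   [/\ ecast B (Sph S (Free S (Pos B))) e A = A',
    ecast B (hom (Free S (Pos B)) (under C)) e t = t' &
    ecast B (Pos B n -> precell C) e tV = tV'].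
Proof.
case=> e; case: B' / e dB' A' fA' t' tV' => dB' A' fA' t' tV' eA et etV.
by exists erefl; split=> /=; [apply: inj_pair2 eA|apply: inj_pair2 et|apply: inj_pair2 etV].
Qed.

Section Recognition.
Variable X : omegacat.

Lemma icomp_free k (C : Comp (tower k)) (rho : interp (interps X k) C) (Y Z : glob)
    (t : hom (Free (tower k) Z) C) (f : globhom Y Z) :
  icomp (interps X k) rho (t \oc freemap k f) = icomp (interps X k) rho t \oc freemap k f.
Proof.
elim: k C rho t => [|k IH] C rho t //.
apply: nhom_ext => [|y]; first exact: IH.
by rewrite /= !nact_var.
Qed.

Local Notation D := (cxtower X).
Local Notation sph k := (isph (interps X k) (cxinterp (D k))).

(** On morphisms out of free computads, the interpretation of [compOf X] in [X]
    comes from a map of globular sets.  This links its values on coherence cells to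
    the composites that define [indecomposable]. *)
Lemma icomp_transpose n (B : tree) (t : nhom (nfree (tower n) (Pos B)) (cxcomp (D n.+1))) :
  dim B <= n ->
  exists f : globhom (Pos B) X, nicomp (cxinterp (D n.+1)) t = nfree_map (tower n) f.
Proof.
move=> dB; have [f ->] := @pos_transpose (compOf X) n B t dB.
exists (globhom_comp (csigma_hom X) f).
rewrite -[LHS]/(icomp (interps X n.+1) (cxinterp (D n.+1)) _) icomp_free.
rewrite [icomp _ _ _](csigma_comp X n.+1).
exact: esym (@fmap_comp GLOB _ (Free (tower n.+1)) _ _ _ _ _).
Qed.

(** Constituents of lower dimension are left out: they are dealt with by induction on
    the dimension. *)
Definition constituent n (y x : X n) : Prop :=
  exists B (dB : dim B <= n) A (fA : full (tower n) B A) (f : globhom (Pos B) X) p,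
    x = ostr X n (ncoh dB fA (nfree_map (tower n) f)) /\ y = f n p.

(** The equality of the two free cells amounts to equalities of the trees, the spheres
    and the maps (up to dimension [n]), without casts. *)
Definition unique_decomposition : Prop :=
  forall n B (dB : dim B <= n) A (fA : full (tower n) B A) (f : globhom (Pos B) X)
    B' (dB' : dim B' <= n) A' (fA' : full (tower n) B' A') (f' : globhom (Pos B') X),
  ostr X n (ncoh dB fA (nfree_map (tower n) f)) =
  ostr X n (ncoh dB' fA' (nfree_map (tower n) f')) ->
  ncoh dB fA (nfree_map (tower n) f) = ncoh dB' fA' (nfree_map (tower n) f').

Hypothesis uniq_dec : unique_decomposition.
Hypothesis wf_dec : forall n, well_founded (@constituent n).

(** Below dimension [k], the morphism from [compOf X] to [X] is bijective.  The
    bijectivity on cells is needed in the form of its consequences for spheres and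
    for morphisms out of free computads. *)
Record free_below k : Prop := FreeBelow {
  below_hom_inj : forall (Y : glob) (t u : hom (Free (tower k) Y) (cxcomp (D k))),
    icomp (interps X k) (cxinterp (D k)) t = icomp (interps X k) (cxinterp (D k)) u -> t = u;
  below_sph_inj : injective (sph k);
  below_sph_surj : forall p, exists A, sph k A = p;
  below_hom_lift : forall (Y : glob) (f : globhom Y X),
    exists t, icomp (interps X k) (cxinterp (D k)) t = freemap k f }.

Lemma free_below0 : free_below 0.
Proof.
have unit_eq (u v : unit) : u = v by case: u v => -[].
split=> [Y t u _|A A' _|p|Y f].
- exact: unit_eq.
- exact: unit_eq.
- by exists tt; apply: unit_eq.
- by exists tt.
Qed.

Section Step.
Variables (n : nat) (H : free_below n).
Local Notation rho := (cxinterp (D n.+1)).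
Local Notation ev := (@nieval X n (interps X n) (cxcomp (D n.+1)) rho).

(** Preimages can be chosen independently for each [y]: they have the right
    boundaries because a sphere of [compOf X] is determined by its image in [X] ([below_sph_inj]). *)
Lemma lift_hom (Y : glob) (f : globhom Y X) :
  (forall y : Y n, exists c, ev c = f n y) ->
  exists t, nicomp rho t = nfree_map (tower n) f.
Proof.
move=> ex; have [t0 et0] := below_hom_lift H f.
have [c ec] : exists c : Y n -> ncell (cxcomp (D n.+1)), forall y, ev (c y) = f n y.
  pose c y := constructive_indefinite_description _ (ex y).
  by exists (fun y => sval (c y)) => y; apply: svalP (c y).
have b (y : Y n) : nbdry (c y) = fmap (Sph (tower n)) t0 (gbdry (tower n) y).
  apply: (below_sph_inj H); apply: par_sph_inj.
  rewrite -icomp_gbdry et0 gbdry_natural -par_sph_gpar; congr par_sph.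
  by rewrite -ec gpar_nieval.
exists (@NHom n (tower n) (nfree (tower n) Y) (cxcomp (D n.+1)) t0 c b).
apply: nhom_ext => [|y]; first exact: et0.
by rewrite /= ec.
Qed.

(** By induction on the constituents.  An indecomposable cell is the image of the
    generator given by itself and the only sphere over its boundary. *)
Lemma ev_surj x : exists c, ev c = x.
Proof.
elim/(well_founded_ind (wf_dec (n := n))): x => x IH.
have [[B [dB [A [fA [f ex]]]]]|ind] := classic (exists B (dB : dim B <= n) A
    (fA : full (tower n) B A) (f : globhom (Pos B) X),
    x = ostr X n (ncoh dB fA (nfree_map (tower n) f))).
  have [p|t et] := @lift_hom _ f.
    by apply: IH; exists B, dB, A, fA, f, p.
  by exists (ncoh dB fA t); rewrite nieval_coh et.
have [A eA] := below_sph_surj H (gpar x).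
by exists (nvar (CxGen ind (esym eA) : gen (cxcomp (D n.+1)))).
Qed.

Lemma ev_coh_dec B (dB : dim B <= n) A (fA : full (tower n) B A) t :
  exists f : globhom (Pos B) X, nicomp rho t = nfree_map (tower n) f /\
    ev (ncoh dB fA t) = ostr X n (ncoh dB fA (nfree_map (tower n) f)).
Proof.
have [f ef] := icomp_transpose t dB.
by exists f; rewrite nieval_coh ef.
Qed.

(** Generators have indecomposable values and are determined by them, since the
    spheres are determined by the boundaries of the values; coherence cells have
    decomposable values, which determine them by [uniq_dec] and induction. *)
Lemma ev_inj : injective ev.
Proof.
elim/ncell_ind_coh => [v|B dB A fA t IH]; elim/ncell_ind_coh => [w|B' dB' A' fA' t' _].
- move=> /= e; congr nvar.
  case: v w e => [Sv x ix px] [Sw y iy py] /=; rewrite !nieval_var /= => e.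
  case: y / e iy py => iy py.
  have e : Sv = Sw by apply: (below_sph_inj H); rewrite -px -py.
  case: Sw / e py => py.
  by rewrite (proof_irrelevance _ ix iy) (proof_irrelevance _ px py).
- have [f [_ ->]] := ev_coh_dec dB' fA' t'.
  by rewrite nieval_var /= => e; case: (@cxind _ _ _ _ v); exists B', dB', A', fA', f.
- have [f [_ ->]] := ev_coh_dec dB fA t.
  by rewrite nieval_var /= => e; case: (@cxind _ _ _ _ w); exists B, dB, A, fA, f.
have [f [ef ->]] := ev_coh_dec dB fA t.
have [f' [ef' ->]] := ev_coh_dec dB' fA' t'.
move=> /uniq_dec /(congr1 sval) /= /precoh_tree_inj [e [eA et etV]].
case: B' / e dB' A' fA' t' f' ef' eA et etV => dB' A' fA' t' f' ef' /= eA et etV.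
case: A' / eA fA' => fA'.
apply: ncell_eq => /=; apply: precoh_ext => [|p].
  apply: (below_hom_inj H).
  have := congr1 (@hunder _ _ _ _) ef; have := congr1 (@hunder _ _ _ _) ef'.
  by rewrite /= et => <-.
congr sval; apply: IH.
have := congr1 (fun h : nhom (nfree (tower n) (Pos B)) (nfree (tower n) X) =>
  sval (hgen h p)) ef.
have := congr1 (fun h : nhom (nfree (tower n) (Pos B)) (nfree (tower n) X) =>
  sval (hgen h p)) ef'.
have := congr1 (fun h => h p) etV.
by move=> /= [->] [->] [->].
Qed.

Lemma free_below_next : free_below n.+1.
Proof.
split=> [Y t u e|A A' e|p|Y f].
- apply: nhom_ext => [|y].
    exact: (below_hom_inj H (congr1 (@hunder _ _ _ _) e)).
  apply: ev_inj.
  have := congr1 (fun h : nhom (nfree (tower n) Y) (nfree (tower n) X) =>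
    sval (hgen h y)) e.
  by case.
- have [e1 e2] := congr1 sval e.
  by apply: nsph_ext; apply: ev_inj.
- have [a ea] := ev_surj (sval p).1; have [b eb] := ev_surj (sval p).2.
  have ab : nbdry a = nbdry b.
    apply: (below_sph_inj H).
    rewrite -[LHS](gpar_nieval rho a) -[RHS](gpar_nieval rho b) ea eb.
    exact: gparallel_gpar (svalP p).
  exists (NSph ab); apply: Par_eq; rewrite /= ea eb.
  by case: (sval p).
- by apply: lift_hom => y; apply: ev_surj.
Qed.
End Step.

Lemma free_below_all k : free_below k.
Proof. by elim: k => [|k IH]; [apply: free_below0|apply: free_below_next]. Qed.

Lemma csigma_bijective n :
  injective (csigma X n) /\ forall x : X n, exists c, csigma X n c = x.
Proof.
by split; [apply: (ev_inj (free_below_all n))|apply: (ev_surj (free_below_all n))].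
Qed.

End Recognition.

Lemma omegahom_inv (X Y : omegacat) (f : omegahom X Y) :
  (forall n, injective (f n)) -> (forall n (y : Y n), exists x, f n x = y) ->
  exists g : omegahom Y X, omegahom_comp g f = omegahom_id X /\
    omegahom_comp f g = omegahom_id Y.
Proof.
move=> finj fsurj.
pose g n y := sval (constructive_indefinite_description _ (fsurj n y)).
have fg n y : f n (g n y) = y by rewrite /g; case: constructive_indefinite_description.
have gs n (y : Y n.+1) : src (g _ y) = g _ (src y).
  by apply: (finj n); rewrite -gmap_src !fg.
have gt n (y : Y n.+1) : tgt (g _ y) = g _ (tgt y).
  by apply: (finj n); rewrite -gmap_tgt !fg.
pose G : globhom Y X := GlobHom gs gt.
have fG : globhom_comp f G = globhom_id Y by apply: globhom_ext => n y; apply: fg.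
have Gstr : globhom_comp G (ostr Y) = globhom_comp (ostr X) (Tmap G).
  apply: globhom_ext => n c; apply: (finj n).
  rewrite [LHS]fg [RHS](ohom_strE f).
  by rewrite -[Tmap f n _]/(globhom_comp (Tmap f) (Tmap G) n c) -Tmap_comp fG Tmap_id.
exists (OmegaHom Gstr); split; apply: omegahom_ext => //.
by apply: globhom_ext => n x; apply: (finj n); apply: fg.
Qed.

(** * Suspension is injective *)

Definition susp_inj k (S : stage k) (S' : stage k.+1) (D : suspdata S S') : Prop :=
  (forall (C E : Comp S) (f g : hom C E), fmap (So D) f = fmap (So D) g -> f = g) /\
  forall C : Comp S, injective (@Ssph k S S' D C).

Section SuspInj.
Variables (n : nat) (S : stage n) (S' : stage n.+1) (D : suspdata S S').

Lemma susp_sph_cancel (X : glob) : susp_inj D ->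
  injective (fun A : Sph S (Free S X) => fmap (Sph S') (idto (SFree D X)) (Ssph D A)).
Proof.
move=> [_ sinj] A A' /(congr1 (fmap (Sph S') (idto (esym (SFree D X))))).
by rewrite !SFreeK => /sinj.
Qed.

Lemma idto_epi (C : category) (a b c : C) (e : a = b) (f g : hom b c) :
  f \oc idto e = g \oc idto e -> f = g.
Proof. by case: b / e f g => f g; rewrite !compf1. Qed.

Lemma tsusp_precoh_inj (C : ncomp S') B B' dB dB' (A : Sph S (Free S (Pos B)))
    (A' : Sph S (Free S (Pos B'))) fA fA' t t' tV tV' :
  susp_inj D ->
  @precoh _ S' C (tsusp B) dB (fmap (Sph S') (idto (SFree D (Pos B))) (Ssph D A)) fA t tV =
  @precoh _ S' C (tsusp B') dB' (fmap (Sph S') (idto (SFree D (Pos B'))) (Ssph D A')) fA'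
    t' tV' ->
  exists e : B = B',
   [/\ ecast B (Sph S (Free S (Pos B))) e A = A',
    ecast B (hom (Free S' (Pos (tsusp B))) (under C)) e t = t' &
    ecast B (Pos B n -> precell C) e tV = tV'].
Proof.
move=> inj /precoh_tree_inj [e].
have eB : B = B' by case: e.
case: B' / eB e dB' A' fA' t' tV' => e dB' A' fA' t' tV'.
rewrite (proof_irrelevance _ e erefl) /= => -[eA et etV].
by exists erefl; split=> //=; apply: susp_sph_cancel inj _ _ eA.
Qed.

Lemma presusp_inj (C : ncomp S) : susp_inj D -> injective (@presusp n S S' D C).
Proof.
move=> inj; elim=> [v|B dB A fA t tV IH] [w|B' dB' A' fA' t' tV'] //=.
  by case=> ->.
move=> /(tsusp_precoh_inj inj) [e [eA et etV]].
case: B' / e dB' A' fA' t' tV' eA et etV => dB' A' fA' t' tV' /= eA et etV.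
case: A' / eA fA' => fA'; apply: precoh_ext => [|p].
  exact: (proj1 inj) (idto_epi et).
by apply: IH; apply: (congr1 (fun h => h p) etV).
Qed.

Lemma susp_inj_next : susp_inj D -> susp_inj (susp_next D).
Proof.
move=> inj; have cinj (C : ncomp S) : injective (@ncell_susp n S S' D C).
  by move=> c c' /(congr1 sval) /(presusp_inj inj) /ncell_eq.
split=> [C E f g e|C A A' e].
  apply: nhom_ext => [|v].
    exact: (proj1 inj) (congr1 (@hunder _ _ _ _) e).
  apply: cinj; exact: (congr1 (fun h : nhom (nsusp D C) (nsusp D E) => hgen h v) e).
by apply: nsph_ext; apply: cinj;
  [apply: (congr1 (@pr1 _ _ _) e)|apply: (congr1 (@pr2 _ _ _) e)].
Qed.

End SuspInj.

Lemma susp_inj_all k : susp_inj (susp k).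
Proof.
elim: k => [|k IH]; last exact: susp_inj_next.
by split=> [C E [] []|C [] []].
Qed.

(** * Hom omega-categories of computads *)

(** A morphism [e] from the suspension of a free computad that is injective on the
    generators of positive dimension is a monomorphism as far as suspended maps
    between free computads are concerned. *)
Lemma susp_free_mono (Z : glob) (C : computad) (e : comphom (SuspC (FreeC Z)) C) :
  (forall n, injective (fun x : Z n => cact e (@suspvar Z n.+1 x))) ->
  forall k (Y : glob) (f g : globhom Y Z),
  thunder (e k.+2) \oc fmap (So (susp k)) (freemap k f) =
  thunder (e k.+2) \oc fmap (So (susp k)) (freemap k g) ->
  freemap k f = freemap k g.
Proof.
move=> einj; elim=> [|k IH] Y f g // /(congr1 (fun h => tie C k.+2 \oc h)).
rewrite !compA htrunc_under [tie (SuspC _) _]idto_id !compf1 => eh.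
apply: nhom_ext => [|y].
  apply: IH; exact: (congr1 (@hunder _ _ _ _) eh).
congr nvar; apply: einj.
have := congr1 (fun h : nhom (nsusp (susp k) (nfree (tower k) Y)) (trunc C k.+2) =>
  hgen h y) eh.
exact.
Qed.

(** The suspension of a coherence cell is a coherence cell over the suspended tree and
    sphere, and [e] acts on its substitution only.  So the tree and the sphere are
    recovered by injectivity of suspension, and [f], up to dimension [n], by the
    hypothesis on [e]. *)
Lemma susp_coh_inj (Z : glob) (C : computad) (e : comphom (SuspC (FreeC Z)) C) :
  (forall n, injective (fun x : Z n => cact e (@suspvar Z n.+1 x))) ->
  forall n B (dB : dim B <= n) A (fA : full (tower n) B A) (f : globhom (Pos B) Z)
    B' (dB' : dim B' <= n) A' (fA' : full (tower n) B' A') (f' : globhom (Pos B') Z),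
  cact e (@suspcell (FreeC Z) n.+1 (ncoh dB fA (nfree_map (tower n) f))) =
  cact e (@suspcell (FreeC Z) n.+1 (ncoh dB' fA' (nfree_map (tower n) f'))) ->
  ncoh dB fA (nfree_map (tower n) f) = ncoh dB' fA' (nfree_map (tower n) f').
Proof.
move=> einj n B dB A fA f B' dB' A' fA' f' /(congr1 sval) /=.
move=> /(tsusp_precoh_inj (susp_inj_all n)) [eB [eA et etV]].
case: B' / eB dB' A' fA' f' eA et etV => dB' A' fA' f' /= eA et etV.
case: A' / eA fA' => fA'.
apply: ncell_eq; apply: precoh_ext => [|p].
  apply: (susp_free_mono einj); apply: (@idto_epi _ _ _ _ (esym (SFree (susp n) (Pos B)))).
  by rewrite -[LHS]compA -[RHS]compA.
congr prevar; apply: einj; apply: ncell_eq.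
exact: (congr1 (fun h => h p) etV).
Qed.

Definition subcell n (S : stage n) (C : ncomp S) (c d : precell C) : Prop :=
  match d with
  | prevar _ => False
  | precoh B _ _ _ _ tV => exists p, tV p = c
  end.

Lemma subcell_wf n (S : stage n) (C : ncomp S) : well_founded (@subcell n S C).
Proof.
elim=> [v|B dB A fA t tV IH]; first by constructor.
by constructor=> c [p <-].
Qed.

Section HomOfComputad.
Variable C : bcomputad.
Local Notation L := (gloop (bCell C)).
Local Notation X := (homcat (BKT C)).

(** The structure map of the hom omega-category suspends and then applies this
    morphism ([hom_strE]), which is, up to [free_susp], the transpose of [gkappa]. *)
Definition loop_counit : comphom (SuspC (FreeC L)) C :=
  comphom_comp (ceps C) (loopT_comp (bCell C)).

Lemma hom_strE n (c : T L n) :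
  sval (ostr X n c) = cact loop_counit (@suspcell (FreeC L) n.+1 c).
Proof. by rewrite [LHS]homcat_strE [RHS]cact_comp. Qed.

Lemma loop_counit_var n (x : L n) : cact loop_counit (@suspvar L n.+1 x) = sval x.
Proof. by rewrite !cact_comp (@free_susp_var L n.+1 x) cact_Free_var ceps_var. Qed.

Lemma loop_counit_inj n : injective (fun x : L n => cact loop_counit (@suspvar L n.+1 x)).
Proof. by move=> x y /= e; apply: gloop_cell_eq; rewrite -!loop_counit_var. Qed.

Lemma hom_unique_decomposition : unique_decomposition X.
Proof.
move=> n B dB A fA f B' dB' A' fA' f' /(congr1 sval).
by rewrite !hom_strE => /(susp_coh_inj loop_counit_inj).
Qed.

Lemma hom_wf n : well_founded (@constituent X n).
Proof.
apply: (wf_incl _ _ (fun y x => subcell (sval (sval y)) (sval (sval x)))); last first.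
  exact: wf_inverse_image (@subcell_wf n.+1 (tower n.+1) (trunc C n.+2)).
move=> _ _ [B [dB [A [fA [f [p [-> ->]]]]]]]; rewrite hom_strE -loop_counit_var.
by exists p.
Qed.

End HomOfComputad.

(** * The functor and the natural isomorphisms *)

Local Notation homcomp C := (compOf (homcat (BKT C))).

Definition hom_sigma (C : bcomputad) : @hom OMEGACAT (KT (homcomp C)) (HOMCAT (BKT C)) :=
  csigma (homcat (BKT C)).

Lemma hom_sigma_iso (C : bcomputad) :
  exists g : @hom OMEGACAT (HOMCAT (BKT C)) (KT (homcomp C)),
    g \oc hom_sigma C = idm _ /\ hom_sigma C \oc g = idm _.
Proof.
have bij n := csigma_bijective (@hom_unique_decomposition C) (@hom_wf C) n.
by apply: omegahom_inv => n; case: (bij n).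
Qed.

Definition hom_sigma_inv (C : bcomputad) : @hom OMEGACAT (HOMCAT (BKT C)) (KT (homcomp C)) :=
  sval (constructive_indefinite_description _ (hom_sigma_iso C)).

Lemma hom_sigmaK (C : bcomputad) : hom_sigma_inv C \oc hom_sigma C = idm _.
Proof. by rewrite /hom_sigma_inv; case: constructive_indefinite_description => g []. Qed.

Lemma hom_sigma_invK (C : bcomputad) : hom_sigma C \oc hom_sigma_inv C = idm _.
Proof. by rewrite /hom_sigma_inv; case: constructive_indefinite_description => g []. Qed.

(** The image under [KT] of this morphism is the action of [f] on hom
    omega-categories, conjugated by the isomorphisms [hom_sigma]. *)
Definition hom_comp_map (C D : bcomputad) (f : @hom BCOMP C D) :
    @hom COMP (homcomp C) (homcomp D) :=
  KT_lift (hom_sigma_inv D \oc (fmap HOMCAT (fmap BKT f) \oc hom_sigma C)).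

Lemma hom_sigma_natural (C D : bcomputad) (f : @hom BCOMP C D) :
  hom_sigma D \oc fmap KT (hom_comp_map f) = fmap HOMCAT (fmap BKT f) \oc hom_sigma C.
Proof.
rewrite -[fmap KT _]/(KTmap _) KT_lift_eq.
by rewrite compA hom_sigma_invK comp1f.
Qed.

Lemma hom_comp_map_unique (C D : bcomputad) (f g : @hom COMP (homcomp C) (homcomp D)) :
  hom_sigma D \oc fmap KT f = hom_sigma D \oc fmap KT g -> f = g.
Proof.
move=> /(congr1 (fun h => hom_sigma_inv D \oc h)).
by rewrite !compA hom_sigmaK !comp1f => /KT_faithful.
Qed.

Definition hom_functoriality : @functoriality BCOMP COMP (fun C => homcomp C).
Proof.
apply: (@Functoriality BCOMP COMP _ hom_comp_map).
- move=> C; apply: hom_comp_map_unique; rewrite hom_sigma_natural.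
  by rewrite !fmap_id comp1f compf1.
- move=> C D E g f; apply: hom_comp_map_unique; rewrite hom_sigma_natural.
  rewrite !fmap_comp -compA -hom_sigma_natural compA -hom_sigma_natural.
  by rewrite -compA.
Defined.

Theorem corollary11 :
  exists omega : @functoriality BCOMP COMP (fun C => compOf (homcat (BKT C))),
    inhabited (natiso (fcomp KT (Functor omega)) (fcomp HOMCAT BKT)) /\
    inhabited (natiso (fcomp CELL (Functor omega)) (fcomp GLOOP BCELL)).
Proof.
exists hom_functoriality; split; constructor.
  exact: (@NatIso _ _ (fcomp KT (Functor hom_functoriality)) (fcomp HOMCAT BKT)
    hom_sigma hom_sigma_inv hom_sigmaK hom_sigma_invK hom_sigma_natural).
(* Both functors to globular sets are the previous two followed by the forgetful
   functor, definitionally. *)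
apply: (@NatIso _ _ (fcomp CELL (Functor hom_functoriality)) (fcomp GLOOP BCELL)
    (fun C => ohom (hom_sigma C)) (fun C => ohom (hom_sigma_inv C)))
  => [C|C|C D f].
- exact: (congr1 (@ohom _ _) (hom_sigmaK C)).
- exact: (congr1 (@ohom _ _) (hom_sigma_invK C)).
- exact: (congr1 (@ohom _ _) (hom_sigma_natural f)).
Qed.
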